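(* Let $(\tilde M^{n+p},\tilde F)$ be a Randers manifold with navigation data $(\tilde h,\tilde W)$ and let $f:M^n\to(\tilde M^{n+p},\tilde F)$ be a submanifold isometrically immersed (i.e. $M$ carries the induced Randers metric $F=f^*\tilde F$), locally given by $\tilde x^\alpha=f^\alpha(x^1,\dots,x^n)$. Then the BH-mean curvature form (resp. the HT-mean curvature form) $\mathcal H_f=\mathcal H_\gamma\,d\tilde x^\gamma$ of $f$ is given by \begin{align*} \mathcal H_\gamma={}&\frac{2(\log\chi)'}{\varrho}\Big[2\varrho' B^{\eta\delta}\tilde W_\delta\tilde W_\tau(\delta^\tau_\gamma-B^\tau_\gamma)-\varrho(\delta^\eta_\gamma-B^\eta_\gamma)\Big]\tilde W_{\alpha|\eta}\tilde W^\alpha\\ &-\frac1{\varrho}\Big\{2\varrho'\Big[(\tilde h^{\alpha\beta}-B^{\alpha\beta})(\delta^\eta_\gamma-B^\eta_\gamma)+B^{\eta\alpha}(\delta^\beta_\gamma-B^\beta_\gamma)\Big]\\ &\qquad-2B^{\eta\beta}\Big[2\varrho''(\tilde h^{\alpha\delta}-B^{\alpha\delta})\tilde W_\delta\tilde W_\tau(\delta^\tau_\gamma-B^\tau_\gamma)-\varrho'(\delta^\alpha_\gamma-B^\alpha_\gamma)\Big]\Big\}\tilde W_{\alpha|\eta}\tilde W_\beta\\ &-\frac1{\varrho}\Big\{h^{ij}\Big[2\varrho'\tilde W_\alpha\tilde W_\beta(\delta^\alpha_\eta-B^\alpha_\eta)(\delta^\beta_\gamma-B^\beta_\gamma)+\varrho(\tilde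 h_{\gamma\eta}-B_{\gamma\eta})\Big]\\ &\qquad+2\tilde W_\delta\tilde W_\tau A^{i\delta}A^{j\tau}\Big[2\varrho''\tilde W_\alpha\tilde W_\beta(\delta^\alpha_\eta-B^\alpha_\eta)(\delta^\beta_\gamma-B^\beta_\gamma)-\varrho'(\tilde h_{\gamma\eta}-B_{\gamma\eta})\Big]\Big\}\tau^\eta_{ij}. \end{align*}
   Context: Navigation data: $\tilde h$ is a Riemannian metric on $\tilde M$ and $\tilde W$ a vector field with $\|\tilde W\|_{\tilde h}<1$; the Randers metric is $\tilde F(\tilde x,y)=\big(\sqrt{\lambda\,\tilde h(y,y)+\tilde h(\tilde W,y)^2}-\tilde h(\tilde W,y)\big)/\lambda$ with $\lambda=1-\|\tilde W\|^2_{\tilde h}$. Index ranges $1\le i,j,k\le n$, $1\le\alpha,\beta,\gamma,\eta,\delta,\tau\le n+p$, with summation convention. Notation: $z^\alpha_i=\partial f^\alpha/\partial x^i$, $\tilde W_\alpha=\tilde h_{\alpha\beta}\tilde W^\beta$, $h_{ij}=\tilde h_{\alpha\beta}z^\alpha_iz^\beta_j$, $(h^{ij})=(h_{ij})^{-1}$, $W_i=\tilde W_\alpha z^\alpha_i$, $\|W\|^2_h=h^{ij}W_iW_j$, $\mathfrak s=1-\|\tilde W\|^2_{\tilde h}+\|W\|^2_h$, $A^{i\alpha}=h^{ij}z^\alpha_j$, $B^{\alpha\beta}=h^{ij}z^\alpha_iz^\beta_j$, $B^\alpha_\beta=B^{\alpha\delta}\tilde h_{\delta\beta}$, $B_{\gamma\eta}=\tilde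 h_{\gamma\alpha}B^\alpha_\eta$. $\tilde W^\beta_{|\eta}$ are the components of $\nabla^{\tilde h}\tilde W$ (Levi-Civita connection of $\tilde h$), $\tilde W_{\alpha|\eta}=\tilde h_{\alpha\beta}\tilde W^\beta_{|\eta}$. $\tau^\alpha_{ij}=\frac{\partial^2f^\alpha}{\partial x^i\partial x^j}+\tilde\Gamma^\alpha_{\tau\delta}z^\tau_jz^\delta_i-\Gamma^k_{ij}z^\alpha_k$ are the coefficients of the second fundamental form of $f:(M,h)\to(\tilde M,\tilde h)$, where $\Gamma,\tilde\Gamma$ are Christoffel symbols of $h,\tilde h$. Volume data: $(\varrho,\chi)=(\mathfrak s^{-n/2},1)$ in the Busemann–Hausdorff (BH) case and $(\varrho,\chi)=(\mathfrak s^{1/2},(1-\|\tilde W\|^2_{\tilde h})^{(n+1)/2})$ in the Holmes–Thompson (HT) case; $\varrho',\varrho''$ are derivatives in $\mathfrak s$, $\chi$ is viewed as a function of $\|\tilde W\|^2_{\tilde h}$ and $(\log\chi)'$ is the derivative with respect to $\|\tilde W\|^2_{\tilde h}$. The induced volume form is $dV_F=\mathcal F(\tilde x,z)\,dx^1\wedge\dots\wedge dx^n$ with $\mathcal F=\frac{\varrho(\mathfrak s)}{\chi}\sqrt{\det(h_{ij})}$, regarded as a function of $\tilde x$ and $z=(z^\alpha_i)$. The mean curvature form $\mathcal H_f=\mathcal H_\gamma d\tilde x^\gamma$ is defined by $\mathcal H_\gamma=\frac1{\mathcal F}\Big\{\frac{\partial\mathcal F}{\partial\tilde x^\gamma}-\frac{\partial^2\mathcal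 F}{\partial z^\gamma_i\partial z^\eta_j}\frac{\partial^2 f^\eta}{\partial x^i\partial x^j}-\frac{\partial^2\mathcal F}{\partial\tilde x^\eta\partial z^\gamma_i}\frac{\partial f^\eta}{\partial x^i}\Big\}$ (BH- or HT-mean curvature form according to the choice of $(\varrho,\chi)$). *)

(* Defs.v *)
(* MathComp-Analysis over an abstract R : realType.
   Everything is in local coordinates: M is an open set U of R^n (row vectors
   'rV_n), tilde M is an open set Ut of R^(n+p). *)
From HB Require Import structures.
From mathcomp Require Import all_boot all_order all_algebra.
From mathcomp Require Import all_classical all_reals all_analysis.
Set Implicit Arguments. Unset Strict Implicit. Unset Printing Implicit Defensive.
Import Order.TTheory GRing.Theory Num.Theory.
Import numFieldNormedType.Exports.
Local Open Scope ring_scope.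
Local Open Scope classical_set_scope.

Section RandersDefs.
Context {R : realType}.

Fixpoint iterD {V W : normedModType R} (vs : seq V) (g : V -> W) : V -> W :=
  if vs is v :: vs' then (fun x => 'D_v (iterD vs' g) x) else g.

Definition smooth_on {V W : normedModType R} (U : set V) (g : V -> W) : Prop :=
  forall vs : seq V,
    (forall x, U x -> {for x, continuous (iterD vs g)}) /\
    (forall x v, U x -> derivable (iterD vs g) x v).

Definition ev {m : nat} (k : 'I_m) : 'rV[R]_m := delta_mx 0 k.

Inductive volume := BH | HT.

Definition rho (vol : volume) (n : nat) (s : R) : R :=
  match vol with
  | BH => s `^ (- (n%:R / 2))
  | HT => s `^ (2^-1)
  end.

Definition chi (vol : volume) (n : nat) (t : R) : R :=
  match vol with
  | BH => 1
  | HT => (1 - t) `^ ((n.+1)%:R / 2)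
  end.

Definition rho1 vol n (s : R) : R := derive1 (rho vol n) s.
Definition rho2 vol n (s : R) : R := derive1 (derive1 (rho vol n)) s.
Definition logchi1 vol n (t : R) : R := derive1 (fun u => ln (chi vol n u)) t.

Variables (n p : nat).
Notation N := (n + p)%N.

(** navigation data in coordinates: ht a b = h~_{ab}, Wt a = W~^a *)
Variables (ht : 'I_N -> 'I_N -> 'rV[R]_N -> R) (Wt : 'I_N -> 'rV[R]_N -> R).

Definition hmat (y : 'rV[R]_N) : 'M[R]_N := \matrix_(a, b) ht a b y.
Definition Wlow (y : 'rV[R]_N) : 'rV[R]_N := \row_a \sum_b ht a b y * Wt b y.
Definition Wnorm2 (y : 'rV[R]_N) : R :=
  \sum_a \sum_b ht a b y * Wt a y * Wt b y.

Definition hz (y : 'rV[R]_N) (z : 'M[R]_(N, n)) : 'M[R]_n := z^T *m hmat y *m z.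
Definition Wi (y : 'rV[R]_N) (z : 'M[R]_(N, n)) : 'rV[R]_n :=
  \row_i \sum_a Wlow y 0 a * z a i.
Definition sfrak (y : 'rV[R]_N) (z : 'M[R]_(N, n)) : R :=
  1 - Wnorm2 y + \sum_i \sum_j invmx (hz y z) i j * Wi y z 0 i * Wi y z 0 j.

Definition calF (vol : volume) (y : 'rV[R]_N) (z : 'M[R]_(N, n)) : R :=
  rho vol n (sfrak y z) / chi vol n (Wnorm2 y) * Num.sqrt (\det (hz y z)).

Definition Gt (a b c : 'I_N) (y : 'rV[R]_N) : R :=
  2^-1 * \sum_m invmx (hmat y) a m *
    ('D_(ev b) (ht m c) y + 'D_(ev c) (ht m b) y - 'D_(ev m) (ht b c) y).

Definition Wupcov (b e : 'I_N) (y : 'rV[R]_N) : R :=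
  'D_(ev e) (Wt b) y + \sum_a Gt b e a y * Wt a y.
Definition Wlowcov (a e : 'I_N) (y : 'rV[R]_N) : R :=
  \sum_b ht a b y * Wupcov b e y.

Variable f : 'I_N -> 'rV[R]_n -> R.

Definition fpt (x : 'rV[R]_n) : 'rV[R]_N := \row_a f a x.
Definition Jf (x : 'rV[R]_n) : 'M[R]_(N, n) := \matrix_(a, i) 'D_(ev i) (f a) x.
Definition d2f (a : 'I_N) (i j : 'I_n) (x : 'rV[R]_n) : R :=
  'D_(ev i) ('D_(ev j) (f a)) x.

Definition hM (i j : 'I_n) (x : 'rV[R]_n) : R := hz (fpt x) (Jf x) i j.
Definition GM (k i j : 'I_n) (x : 'rV[R]_n) : R :=
  2^-1 * \sum_l invmx (\matrix_(a, b) hM a b x) k l *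
    ('D_(ev i) (hM l j) x + 'D_(ev j) (hM l i) x - 'D_(ev l) (hM i j) x).

Definition tau2 (a : 'I_N) (i j : 'I_n) (x : 'rV[R]_n) : R :=
  d2f a i j x + \sum_t \sum_d Gt a t d (fpt x) * Jf x t j * Jf x d i
  - \sum_k GM k i j x * Jf x a k.

Definition Hmean (vol : volume) (x : 'rV[R]_n) (gam : 'I_N) : R :=
  let y := fpt x in let z := Jf x in
  (calF vol y z)^-1 *
  ( 'D_(ev gam) (fun y' => calF vol y' z) y
    - \sum_i \sum_j \sum_e
        'D_(delta_mx gam i) ('D_(delta_mx e j) (calF vol y)) z * d2f e i j x
    - \sum_e \sum_i
        'D_(ev e) (fun y' => 'D_(delta_mx gam i) (calF vol y') z) y * Jf x e i ).

Definition Hformula (vol : volume) (x : 'rV[R]_n) (gam : 'I_N) : R :=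
  let y := fpt x in let z := Jf x in
  let hinv := invmx (hz y z) in
  let A := hinv *m z^T in
  let B := z *m hinv *m z^T in
  let Bmix := B *m hmat y in
  let Blow := hmat y *m Bmix in
  let P := 1%:M - Bmix in
  let Q := hmat y - Blow in
  let Hi := invmx (hmat y) - B in
  let Wl := fun a => Wlow y 0 a in
  let s := sfrak y z in
  let r0 := rho vol n s in
  let r1 := rho1 vol n s in
  let r2 := rho2 vol n s in
  let lc := logchi1 vol n (Wnorm2 y) in
  2 * lc / r0 *
    (\sum_e \sum_al
       (2 * r1 * (\sum_d \sum_t B e d * Wl d * Wl t * P t gam) - r0 * P e gam)
       * Wlowcov al e y * Wt al y)
  - r0^-1 *
    (\sum_al \sum_be \sum_e
       (2 * r1 * (Hi al be * P e gam + B e al * P be gam)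
        - 2 * B e be *
            (2 * r2 * (\sum_d \sum_t Hi al d * Wl d * Wl t * P t gam)
             - r1 * P al gam))
       * Wlowcov al e y * Wl be)
  - r0^-1 *
    (\sum_i \sum_j \sum_e
       (hinv i j *
          (2 * r1 * (\sum_al \sum_be Wl al * Wl be * P al e * P be gam)
           + r0 * Q gam e)
        + 2 * (\sum_d \sum_t Wl d * Wl t * A i d * A j t) *
          (2 * r2 * (\sum_al \sum_be Wl al * Wl be * P al e * P be gam)
           - r1 * Q gam e))
       * tau2 e i j x).

End RandersDefs.

(* Main.v *)
(** Every quantity entering F depends on the point only through the metric H, the
    covector w = H W, its squared norm t, and the jet z.  Writing the derivative of H in
    direction e as G^T H + H G and that of w as nabla_e W + G^T w, with G the matrix of
    Christoffel symbols, a displacement of the base point acts on F and on dF/dz exactly as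
    the variation G z of the jet together with the covariant derivative of W.  The first
    derivative of F in z involves only the normal part nu of w and the tangential
    coordinates a of W; a second differentiation gives explicit coefficients whose part
    antisymmetric in (i, j) disappears when contracted with the symmetric second derivatives
    of f.  The Christoffel terms of the ambient metric recombine with these second
    derivatives into the second fundamental form, and those of the induced metric drop out
    because nu and Q = H - H B H vanish on the tangent space. *)
Require Import Defs.
From HB Require Import structures.
From mathcomp Require Import all_boot all_order all_algebra perm.
From mathcomp Require Import all_classical all_reals all_analysis.
From mathcomp Require Import ring.
Set Implicit Arguments. Unset Strict Implicit. Unset Printing Implicit Defensive.
Import Order.TTheory GRing.Theory Num.Theory.
Import numFieldNormedType.Exports.
Local Open Scope ring_scope.
Local Open Scope classical_set_scope.

(** * Directional derivatives and matrix calculus *)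


Section DirectionalDerivatives.
Context {R : realType} {V : normedModType R}.
Implicit Types (x v : V).

(** Only directional derivatives occur in the definitions. Restricting to the line through [x] turns
    each of them into a one-variable derivative at 0, so the chain rule and locality of real
    analysis apply. *)
Lemma is_derive_lineP (W : normedModType R) (f : V -> W) x v df :
  is_derive x v f df <-> is_derive (0 : R) 1 (fun h : R => f (h *: v + x)) df.
Proof.
have E : (fun h : R => h^-1 *: (f (h *: v + x) - f x)) =
         (fun h : R => h^-1 *: (f ((h *: 1 + 0 : R) *: v + x) - f ((0 : R) *: v + x))).
  by apply/funext => h; rewrite addr0 scale0r add0r [_%:A]mulr1.
split=> -[dfx <-]; apply: DeriveDef.
- by move: dfx; rewrite /derivable /= E.
- by rewrite /derive /= E.
- by move: dfx; rewrite /derivable /= E.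
- by rewrite /derive /= E.
Qed.

(** A directional derivative sees only the line, so agreement on the line suffices; [near_line_gt0]
    and [near_line_open] supply open conditions of exactly this kind. *)
Lemma near_line_is_derive (W : normedModType R) (f g : V -> W) x v df :
  (\forall h \near (0 : R), f (h *: v + x) = g (h *: v + x)) ->
  is_derive x v f df -> is_derive x v g df.
Proof.
move=> fg /is_derive_lineP dfx; apply/is_derive_lineP.
exact: near_eq_is_derive fg dfx.
Qed.

Lemma cvg_line (f : V -> R) x v :
  derivable f x v -> f (h *: v + x) @[h --> (0 : R)] --> f x.
Proof.
move=> /derivable1P/derivable1_diffP/differentiable_continuous.
by rewrite /prop_for /continuous_at /= scale0r add0r.
Qed.

Lemma near_line_gt0 (f : V -> R) x v :
  derivable f x v -> 0 < f x -> \forall h \near (0 : R), 0 < f (h *: v + x).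
Proof. by move=> /cvg_line fc f0; exact: (cvgr_gt _ fc). Qed.

Lemma near_line_open (U : set V) x v :
  open U -> U x -> \forall h \near (0 : R), U (h *: v + x).
Proof.
move=> oU Ux.
have : (h *: v + x) @[h --> (0 : R)] --> x.
  rewrite -[X in _ --> X]add0r -[X in _ --> X + _](scale0r v).
  apply: cvgD; last exact: cvg_cst.
  by apply: cvgZr_tmp; exact: cvg_id.
by apply; exact: open_nbhs_nbhs.
Qed.

Lemma is_derive_comp_real (f : V -> R) (g : R -> R) x v df dg :
  is_derive x v f df -> is_derive (f x) 1 g dg ->
  is_derive x v (fun y => g (f y)) (dg * df).
Proof.
move=> /is_derive_lineP dfx dgx; apply/is_derive_lineP.
have dgx0 : is_derive (f ((0 : R) *: v + x)) 1 g dg by rewrite scale0r add0r.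
exact: (is_derive1_comp dgx0 dfx).
Qed.

Lemma is_derive_mul (f g : V -> R) x v df dg :
  is_derive x v f df -> is_derive x v g dg ->
  is_derive x v (fun y => f y * g y) (df * g x + f x * dg).
Proof.
move=> dfx dgx; apply: (is_derive_eq (is_deriveM dfx dgx)).
by rewrite addrC /GRing.scale /= [g x * _]mulrC.
Qed.

Lemma is_derive_add (f g : V -> R) x v df dg :
  is_derive x v f df -> is_derive x v g dg ->
  is_derive x v (fun y => f y + g y) (df + dg).
Proof. by move=> dfx dgx; exact: (is_deriveD dfx dgx). Qed.

Lemma is_derive_sub (f g : V -> R) x v df dg :
  is_derive x v f df -> is_derive x v g dg ->
  is_derive x v (fun y => f y - g y) (df - dg).
Proof. by move=> dfx dgx; exact: (is_deriveB dfx dgx). Qed.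

Lemma is_derive_const (W : normedModType R) (c : W) x v : is_derive x v (fun=> c) 0.
Proof. exact: is_derive_cst. Qed.

Lemma is_derive_inv (f : V -> R) x v df :
  f x != 0 -> is_derive x v f df ->
  is_derive x v (fun y => (f y)^-1) (- (f x) ^- 2 * df).
Proof.
move=> fx0 dfx; apply: DeriveDef; first by apply: derivableV => //; exact: ex_derive.
by rewrite deriveV // ?derive_val //; exact: ex_derive.
Qed.

Lemma is_derive_bigsum (I : Type) (r : seq I) (P : pred I) (f : I -> V -> R)
    x v (df : I -> R) :
  (forall i, is_derive x v (f i) (df i)) ->
  is_derive x v (fun y => \sum_(i <- r | P i) f i y) (\sum_(i <- r | P i) df i).
Proof.
move=> dfx; elim: r => [|i r IH].
  rewrite big_nil (_ : (fun _ => _) = fun=> 0); first exact: is_derive_cst.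
  by apply/funext => y; rewrite big_nil.
rewrite big_cons (_ : (fun _ => _) = fun y => if P i then f i y +
    \sum_(j <- r | P j) f j y else \sum_(j <- r | P j) f j y).
  by case: (P i) => //; exact: is_derive_add.
by apply/funext => y; rewrite big_cons.
Qed.

Lemma is_derive_bigprod n (f : 'I_n -> V -> R) x v (df : 'I_n -> R) :
  (forall i, is_derive x v (f i) (df i)) ->
  is_derive x v (fun y => \prod_i f i y)
    (\sum_k \prod_i (if i == k then df i else f i x)).
Proof.
elim: n f df => [|n IH] f df dfx.
  rewrite big_ord0 (_ : (fun _ => _) = fun=> 1); first exact: is_derive_cst.
  by apply/funext => y; rewrite big_ord0.
rewrite (_ : (fun _ => _) = fun y => f ord0 y * \prod_i f (lift ord0 i) y);
  last by apply/funext => y; rewrite big_ord_recl.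
apply: (is_derive_eq (is_derive_mul (dfx ord0) (IH _ _ (fun i => dfx _)))).
rewrite big_ord_recl; congr (_ + _); first by rewrite big_ord_recl eqxx.
rewrite mulr_sumr; apply: eq_bigr => k _; rewrite big_ord_recl /=.
by congr (_ * _); apply: eq_bigr => i _; rewrite (inj_eq lift_inj).
Qed.

End DirectionalDerivatives.

Section MatrixCalculus.
Context {R : realType} {V : normedModType R}.
Implicit Types (x v : V).

Lemma is_derive_mxP m n (A : V -> 'M[R]_(m, n)) x v dA :
  is_derive x v A dA <-> forall i j, is_derive x v (fun y => A y i j) (dA i j).
Proof.
split=> [[dAx <-] i j|dAx].
  by apply: DeriveDef; [exact: ((derivable_mxP _ _ _).1 dAx) | rewrite derive_mx // mxE].
have dA' : derivable A x v by apply/derivable_mxP => i j; case: (dAx i j).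
apply: DeriveDef => //; rewrite derive_mx //.
by apply/matrixP => i j; rewrite mxE derive_val.
Qed.

Lemma is_derive_mulmx m n p (A : V -> 'M[R]_(m, n)) (B : V -> 'M[R]_(n, p))
    x v dA dB :
  is_derive x v A dA -> is_derive x v B dB ->
  is_derive x v (fun y => A y *m B y) (dA *m B x + A x *m dB).
Proof.
move=> /is_derive_mxP dAx /is_derive_mxP dBx; apply/is_derive_mxP => i j.
rewrite (_ : (fun _ => _) = fun y => \sum_k A y i k * B y k j);
  last by apply/funext => y; rewrite mxE.
apply: (is_derive_eq (is_derive_bigsum _ _ (fun k =>
  is_derive_mul (dAx i k) (dBx k j)))).
by rewrite !mxE -big_split.
Qed.

Lemma is_derive_trmx m n (A : V -> 'M[R]_(m, n)) x v dA :
  is_derive x v A dA -> is_derive x v (fun y => (A y)^T) dA^T.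
Proof.
move=> /is_derive_mxP dAx; apply/is_derive_mxP => i j.
rewrite (_ : (fun _ => _) = fun y => A y j i) ?mxE //.
by apply/funext => y; rewrite mxE.
Qed.

Lemma is_derive_mxtrace n (A : V -> 'M[R]_n) x v dA :
  is_derive x v A dA -> is_derive x v (fun y => \tr (A y)) (\tr dA).
Proof. by move=> /is_derive_mxP dAx; apply: is_derive_bigsum. Qed.

(** Jacobi's formula: the product rule in the Leibniz expansion differentiates one row at a time. *)
Lemma is_derive_det n (A : V -> 'M[R]_n) x v dA :
  is_derive x v A dA ->
  is_derive x v (fun y => \det (A y)) (\tr (\adj (A x) *m dA)).
Proof.
move=> /is_derive_mxP dAx.
have -> : \tr (\adj (A x) *m dA) =
    \sum_(s : 'S_n) (-1) ^+ s *
      \sum_k \prod_i (if i == k then dA i (s i) else A x i (s i)).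
  under [RHS]eq_bigr do rewrite mulr_sumr.
  rewrite exchange_big mxtrace_mulC /=; apply: eq_bigr => k _.
  (* [A x] with row [k] replaced by that of [dA]. Laplace expansion along row [k] meets only
     cofactors of [A x], which are the entries of the adjugate. *)
  pose Ak := \matrix_(i, j) (if i == k then dA i j else A x i j).
  transitivity (\det Ak).
    rewrite (expand_det_row _ k) mxE; apply: eq_bigr => j _.
    rewrite !mxE eqxx; congr (_ * (_ * \det _)).
    by apply/matrixP => a b; rewrite !mxE eq_sym (negPf (neq_lift _ _)).
  apply: eq_bigr => s _; congr (_ * _).
  by apply: eq_bigr => i _; rewrite mxE.
rewrite /determinant; apply: is_derive_bigsum => s.
apply: (is_derive_eq (is_derive_mul (is_derive_const _ _ _)
  (is_derive_bigprod (fun i => dAx i _)))).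
by rewrite mul0r add0r.
Qed.

Lemma adj_unitmx n (A : 'M[R]_n) : A \in unitmx -> \adj A = \det A *: invmx A.
Proof.
move=> uA; rewrite /invmx uA scalerA divff ?scale1r //.
by rewrite -unitfE -unitmxE.
Qed.

(** Cramer's formula gives derivability; the value then follows by differentiating the identity
    between [A y *m invmx (A y)] and [1%:M], which holds near [x] on the line. *)
Lemma is_derive_invmx n (A : V -> 'M[R]_n) x v dA :
  A x \in unitmx -> is_derive x v A dA ->
  is_derive x v (fun y => invmx (A y)) (- (invmx (A x) *m dA *m invmx (A x))).
Proof.
move=> uA dAx.
have dn0 : \det (A x) != 0 by rewrite -unitfE -unitmxE.
have ddet := is_derive_det dAx.
have nu : \forall h \near (0 : R), A (h *: v + x) \in unitmx.
  have dc := cvg_line (@ex_derive _ _ _ _ _ _ _ ddet).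
  by near do rewrite unitmxE unitfE; exact: (cvgr_neq0 _ dc).
have dI : derivable (fun y => invmx (A y)) x v.
  have dadj i j : derivable (fun y => cofactor (A y) j i) x v.
    have dminor : is_derive x v (fun y => row' j (col' i (A y)))
        (row' j (col' i dA)).
      apply/is_derive_mxP => a b.
      rewrite (_ : (fun _ => _) = fun y => A y (lift j a) (lift i b)).
        by rewrite !mxE; exact: ((is_derive_mxP _ _ _ _).1 dAx _ _).
      by apply/funext => y; rewrite !mxE.
    exact: (ex_derive (is_derive := is_derive_mul (is_derive_const _ _ _)
      (is_derive_det dminor))).
  apply/derivable_mxP => i j.
  suff : is_derive x v (fun y => invmx (A y) i j)
     ('D_v (fun y => (\det (A y))^-1 * cofactor (A y) j i) x).
    by case.
  apply: (@near_line_is_derive _ _ _ (fun y => (\det (A y))^-1 * cofactor (A y) j i)).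
    by near=> h; rewrite /invmx (near nu h) // !mxE.
  apply/derivableP.
  have dq := is_derive_mul (is_derive_inv (f := fun y => \det (A y)) dn0 ddet)
    (derivableP (dadj i j)).
  exact: (@ex_derive _ _ _ _ _ _ _ dq).
have [_ dIv] := (derivableP dI).
set dB := 'D_v _ x in dIv.
have := is_derive_mulmx dAx (derivableP dI).
rewrite -/dB => dAB.
have d0 : is_derive x v (fun y => A y *m invmx (A y)) 0.
  apply: (@near_line_is_derive _ _ _ (fun=> 1%:M)).
  by near=> h; rewrite mulmxV //; near: h.
have /eqP : dA *m invmx (A x) + A x *m dB = 0.
  by rewrite -(@derive_val _ _ _ _ _ _ _ dAB) (@derive_val _ _ _ _ _ _ _ d0).
rewrite addrC addr_eq0 => /eqP E.
apply: DeriveDef => //; rewrite -/dB -(mul1mx dB) -(mulVmx uA).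
by rewrite -(mulmxA _ (A x)) E mulmxN mulmxA.
Unshelve. all: by end_near. Qed.

End MatrixCalculus.

(** * Symmetry of second derivatives, positive definiteness, volume functions *)


Section Schwarz.
Context {R : realType} {V : normedModType R}.
Implicit Types (g : V -> R) (x u v y : V).

Lemma is_derive_along g y u (s : R) :
  derivable g (s *: u + y) u ->
  is_derive s 1 (fun s' : R => g (s' *: u + y)) ('D_u g (s *: u + y)).
Proof.
move=> /derivableP/is_derive_lineP dg; apply/is_derive_lineP.
rewrite (_ : (fun _ => _) = fun h : R => g (h *: u + (s *: u + y))) //.
by apply/funext => h; rewrite addrA -scalerDl /GRing.scale /= mulr1.
Qed.

Lemma MVT_along g y u (h : R) : 0 <= h ->
  (forall s, s \in `[0, h]%R -> derivable g (s *: u + y) u) ->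
  exists2 c, c \in `[0, h]%R &
    g (h *: u + y) - g y = 'D_u g (c *: u + y) * h.
Proof.
move=> h0 dg.
have [||c ch E] := @MVT_segment R (fun s : R => g (s *: u + y))
    (fun s => 'D_u g (s *: u + y)) 0 h h0.
- move=> s; rewrite in_itv => /= /andP[s0 sh]; apply: is_derive_along; apply: dg.
  by rewrite in_itv /= !ltW.
- apply: derivable_within_continuous => s sh.
  by have [] := is_derive_along (dg s sh).
by exists c => //; move: E; rewrite scale0r add0r subr0.
Qed.

(** The mean value theorem is applied twice: along [u] to the increment [G] of [g] in direction [v],
    then along [v] to the derivative of [g] in direction [u]. *)
Lemma second_difference g x u v (h : R) (U : set V) : 0 <= h ->
  (forall s t, s \in `[0, h]%R -> t \in `[0, h]%R -> U (s *: u + t *: v + x)) ->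
  (forall y, U y -> derivable g y u) ->
  (forall y, U y -> derivable ('D_u g) y v) ->
  exists s t, [/\ s \in `[0, h]%R, t \in `[0, h]%R &
   g (h *: u + h *: v + x) - g (h *: u + x) - g (h *: v + x) + g x =
   'D_v ('D_u g) (s *: u + t *: v + x) * (h * h)].
Proof.
move=> h0 hU du dvu.
have h0h : h \in `[0, h]%R by rewrite in_itv /= h0 lexx.
have z0h : 0 \in `[0, h]%R by rewrite in_itv /= h0 lexx.
pose G y := g (h *: v + y) - g y.
have dG y : U y -> U (h *: v + y) ->
    is_derive y u G ('D_u g (h *: v + y) - 'D_u g y).
  move=> Uy Uvy; apply: is_derive_sub; last exact/derivableP/du.
  have /derivableP/is_derive_lineP dg := du _ Uvy; apply/is_derive_lineP.
  rewrite (_ : (fun _ => _) = fun k : R => g (k *: u + (h *: v + y))) //.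
  by apply/funext => k; rewrite addrCA.
have Us s : s \in `[0, h]%R -> U (s *: u + x).
  by move=> sh; have := hU s 0 sh z0h; rewrite scale0r addr0.
have Uvs s : s \in `[0, h]%R -> U (h *: v + (s *: u + x)).
  by move=> sh; have := hU s h sh h0h; rewrite (addrC (s *: u)) addrA.
have [|s sh Es] := @MVT_along G x u h h0.
  by move=> s sh; have [] := dG _ (Us s sh) (Uvs s sh).
have [|t th Et] := @MVT_along ('D_u g) (s *: u + x) v h h0.
  move=> t th; apply: dvu; rewrite addrCA addrA; exact: hU.
exists s, t; split => //.
have -> : s *: u + t *: v + x = t *: v + (s *: u + x) by rewrite addrCA addrA.
rewrite mulrA -Et -(@derive_val _ _ _ _ _ _ _ (dG _ (Us s sh) (Uvs s sh))) -Es /G.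
have -> : h *: u + h *: v + x = h *: v + (h *: u + x) by rewrite addrCA addrA.
by ring.
Qed.

(** Schwarz's theorem: the second difference is symmetric in [u] and [v], hence equals [h * h] times
    either mixed derivative at suitable nearby points, and continuity carries the equality to
    [x]. *)
Lemma derive_commute g x u v (U : set V) : open U -> U x ->
  (forall y, U y -> derivable g y u) -> (forall y, U y -> derivable g y v) ->
  (forall y, U y -> derivable ('D_u g) y v) ->
  (forall y, U y -> derivable ('D_v g) y u) ->
  {for x, continuous ('D_v ('D_u g))} -> {for x, continuous ('D_u ('D_v g))} ->
  'D_u ('D_v g) x = 'D_v ('D_u g) x.
Proof.
move=> oU Ux du dv dvu duv cvu cuv.
apply/eqP; rewrite -subr_eq0 -normr_le0; apply/ler_addgt0Pl => e e0.
rewrite addr0.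
have e20 : 0 < e / 2 by rewrite divr_gt0.
have N1 : \forall y \near x, `|'D_v ('D_u g) x - 'D_v ('D_u g) y| <= e / 2.
  by move/cvgrPdist_le : cvu => /(_ _ e20).
have N2 : \forall y \near x, `|'D_u ('D_v g) x - 'D_u ('D_v g) y| <= e / 2.
  by move/cvgrPdist_le : cuv => /(_ _ e20).
have N3 : \forall y \near x, U y by exact: open_nbhs_nbhs.
have [r /= r0 Hr] := (nbhs_ballP _ _).1 (filterI (filterI N1 N2) N3).
(* The summand 1 makes [M] positive even for null directions; with [h * M] equal to [r / 2] the
   whole parallelogram stays in the ball of radius [r]. *)
pose M := `|u| + `|v| + 1.
have M0 : 0 < M by rewrite ltr_wpDl // addr_ge0.
pose h := r / 2 / M.
have h0 : 0 < h by rewrite !divr_gt0.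
have inB s t : s \in `[0, h]%R -> t \in `[0, h]%R -> ball x r (s *: u + t *: v + x).
  rewrite !in_itv /= => /andP[s0 sh] /andP[t0 th].
  rewrite -ball_normE /= opprD addrCA subrr addr0 normrN.
  apply: (le_lt_trans (ler_normD _ _)); rewrite !normrZ !ger0_norm //.
  apply: (@le_lt_trans _ _ (h * M)).
    rewrite /M !mulrDr mulr1; apply: ler_wpDr; first exact: ltW.
    by apply: lerD; apply: ler_wpM2r.
  by rewrite /h divfK ?gt_eqF // ltr_pdivrMr // ltr_pMr // ltr1n.
have [s [t [sh th E1]]] := second_difference (ltW h0)
  (fun s t sh th => (Hr _ (inB s t sh th)).2) du dvu.
have inB' t' s' : t' \in `[0, h]%R -> s' \in `[0, h]%R -> ball x r (t' *: v + s' *: u + x).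
  by move=> th' sh'; rewrite (addrC (t' *: v)); exact: inB.
have [t' [s' [th' sh' E2]]] := second_difference (ltW h0)
  (fun s t sh th => (Hr _ (inB' s t sh th)).2) dv duv.
have E : 'D_u ('D_v g) (t' *: v + s' *: u + x) = 'D_v ('D_u g) (s *: u + t *: v + x).
  apply: (@mulIf _ (h * h)); first by rewrite mulf_neq0 // gt_eqF.
  apply: etrans (esym E2) (etrans _ E1).
  by rewrite (addrC (h *: v)); congr (_ + _); rewrite addrAC.
have [[B1 _] _] := Hr _ (inB s t sh th).
have [[_ B2] _] := Hr _ (inB' t' s' th' sh').
move: E B1 B2.
generalize ('D_u ('D_v g) (t' *: v + s' *: u + x)) ('D_v ('D_u g) (s *: u + t *: v + x)).
generalize ('D_u ('D_v g) x) ('D_v ('D_u g) x) => a b c d -> B1 B2.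
by apply: (le_trans (ler_distD d _ _)); rewrite [leRHS](splitr e) lerD // distrC.
Qed.

End Schwarz.

Section PositiveDefinite.
Context {R : realType}.

Lemma posdef_unitmx n (A : 'M[R]_n) :
  (forall v : 'rV[R]_n, v != 0 -> 0 < (v *m A *m v^T) 0 0) -> A \in unitmx.
Proof.
move=> Apos; rewrite unitmxE unitfE; apply/negP => /det0P[v v0 vA].
by have := Apos v v0; rewrite vA mul0mx mxE ltxx.
Qed.

(** The segment from the identity to [A] consists of positive definite, hence invertible, matrices.
    The determinant is 1 at the start and never vanishes, so by the intermediate value theorem it
    ends positive. *)
Lemma posdef_det_gt0 n (A : 'M[R]_n) :
  (forall v : 'rV[R]_n, v != 0 -> 0 < (v *m A *m v^T) 0 0) -> 0 < \det A.
Proof.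
move=> Apos.
pose M (t : R) := (1 - t) *: 1%:M + t *: A.
have dM (t : R) : is_derive t 1 M (A - 1%:M).
  apply/is_derive_mxP => i j.
  rewrite (_ : (fun _ => _) = fun t => (1 - t) * 1%:M i j + t * A i j).
    apply: (is_derive_eq (is_derive_add
      (is_derive_mul (is_derive_sub (is_derive_const (1 : R) t 1) (is_derive_id t 1))
        (is_derive_const (1%:M i j : R) t 1))
      (is_derive_mul (is_derive_id t 1) (is_derive_const (A i j) t 1)))).
    by rewrite !mxE; ring.
  by apply/funext => y; rewrite !mxE.
have detM_neq0 t : 0 <= t <= 1 -> \det (M t) != 0.
  move=> /andP[t0 t1]; rewrite -unitfE -unitmxE; apply: posdef_unitmx => v v0.
  rewrite /M mulmxDr mulmxDl -!scalemxAr -!scalemxAl mulmx1 mxE [X in X + _]mxE [X in _ + X]mxE.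
  have vv : 0 < (v *m v^T) 0 0.
    have /rV0Pn[i vi] := v0.
    rewrite mxE (bigD1 i) //= mxE ltr_pwDl //; first by rewrite -expr2 lt_def sqrf_eq0 vi sqr_ge0.
    by apply: sumr_ge0 => j _; rewrite mxE -expr2 sqr_ge0.
  have := Apos v v0; move: vv; set p := (_ *m _) _ _; set q := (_ *m _) _ _ => p0 q0.
  (* For [t] nonzero the strict inequality comes from [t * q]; at [t = 0] it must come from [p]. *)
  have [->|tn0] := eqVneq t 0; first by rewrite mul0r addr0 subr0 mul1r.
  rewrite ltr_wpDl //; first by rewrite mulr_ge0 ?subr_ge0 // ltW.
  by rewrite mulr_gt0 // lt_def tn0.
rewrite ltNge; apply/negP => dA.
have dc : {within `[0, 1], continuous (fun t => \det (M t))}.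
  apply: derivable_within_continuous => t _.
  by have [] := is_derive_det (dM t).
have [|c c01 c0] := @IVT R (fun t => \det (M t)) 0 1 0 ler01 dc.
  rewrite /M subr0 subrr scale1r !scale0r scale1r addr0 add0r det1.
  by rewrite ge_min le_max dA ler01 orbT.
by have := detM_neq0 c; rewrite c0 eqxx => /(_ c01).
Qed.

End PositiveDefinite.

Section VolumeFunctions.
Context {R : realType}.
Variables (vol : volume) (n : nat).

(** In both volume cases [rho] is a real power, so the two cases are differentiated together. *)
Lemma rhoE : exists k : R, rho vol n = fun s : R => s `^ k.
Proof. by case: vol => /=; eexists. Qed.

Lemma is_derive_rho (s : R) : 0 < s -> is_derive s 1 (rho vol n) (rho1 vol n s).
Proof.
have [k rhok] := rhoE => s0; have [d _] := is_derive1_powR k s0.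
by rewrite /rho1 derive1E rhok; exact: derivableP.
Qed.

Lemma is_derive_rho1 (s : R) : 0 < s -> is_derive s 1 (rho1 vol n) (rho2 vol n s).
Proof.
have [k rhok] := rhoE => s0.
have d : derivable (rho1 vol n) s 1.
  apply: (@near_eq_derivable _ _ _ (fun y => k * y `^ (k - 1))).
    near=> y; rewrite /rho1 rhok powR_derive1 // in_itv /= andbT.
    by near: y; exact: lt_nbhsr.
  by have [] := is_derive_mul (is_derive_const k s 1) (is_derive1_powR (k - 1) s0).
by rewrite /rho2 derive1E; exact: (derivableP d).
Unshelve. all: by end_near. Qed.

Lemma rho_gt0 (s : R) : 0 < s -> 0 < rho vol n s.
Proof. by have [k ->] := rhoE => s0; exact: powR_gt0. Qed.

Lemma chi_gt0 (t : R) : t < 1 -> 0 < chi vol n t.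
Proof. by case: vol => //= t1; rewrite powR_gt0 // subr_gt0. Qed.

(** Writing the derivative through the logarithmic derivative lets [chi] factor out of every later
    variation. *)
Lemma is_derive_chi (t : R) : t < 1 ->
  is_derive t 1 (chi vol n) (logchi1 vol n t * chi vol n t).
Proof.
move=> t1.
have d : derivable (chi vol n) t 1.
  case: vol => /=; first by have [] := is_derive_const (1 : R) t 1.
  have t1' : 0 < 1 - t by rewrite subr_gt0.
  by have [] := is_derive_comp_real (is_derive_sub (is_derive_const (1 : R) t 1)
    (is_derive_id t 1)) (is_derive1_powR (n.+1%:R / 2) t1').
have c0 := chi_gt0 t1.
have dl := is_derive_comp_real (derivableP d) (is_derive1_ln c0).
rewrite /logchi1 derive1E (@derive_val _ _ _ _ _ _ _ dl) mulrAC mulVf ?gt_eqF //.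
by rewrite mul1r; exact: derivableP.
Qed.

End VolumeFunctions.

(** * First and second variation of the volume density *)


Section Variations.
Context {R : realType} {V : normedModType R} (n : nat).
(** Intended reading: [K] is the Gram matrix of the induced metric, [u] the pulled-back covector,
    [t] the squared norm of the wind. For a jet direction [W], [m] is the derivative of [u] and
    [L + L^T] that of [K]. *)
Variables (x v : V) (K L : V -> 'M[R]_n) (u m : V -> 'cV[R]_n) (t : V -> R).
Variables (dK dL : 'M[R]_n) (du dm : 'cV[R]_n) (dt : R).
Hypotheses (hK : is_derive x v K dK) (hL : is_derive x v L dL).
Hypotheses (hu : is_derive x v u du) (hm : is_derive x v m dm).
Hypothesis ht : is_derive x v t dt.
Hypotheses (Ksym : (K x)^T = K x) (detK_gt0 : 0 < \det (K x)).

Let Ki := invmx (K x).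
Let a := Ki *m u x.

Lemma unitmx_det_gt0 : K x \in unitmx.
Proof. by rewrite unitmxE unitfE gt_eqF. Qed.

Let Kisym : Ki^T = Ki.
Proof. by rewrite /Ki trmx_inv Ksym. Qed.

(** Here [a] solves [K a = u], so its derivative solves the same system with right-hand side
    [du - dK *m a]. *)
Lemma is_derive_solve :
  is_derive x v (fun y => invmx (K y) *m u y) (Ki *m (du - dK *m a)).
Proof.
apply: (is_derive_eq (is_derive_mulmx (is_derive_invmx unitmx_det_gt0 hK) hu)).
by rewrite mulNmx mulmxBr addrC -!mulmxA.
Qed.

Lemma is_derive_quad :
  is_derive x v (fun y => \tr ((u y)^T *m (invmx (K y) *m u y)))
    (2 * \tr (du^T *m a) - \tr (a^T *m dK *m a)).
Proof.
apply: (is_derive_eq (is_derive_mxtrace (is_derive_mulmx (is_derive_trmx hu)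
  is_derive_solve))).
have aT : a^T = (u x)^T *m Ki by rewrite trmx_mul Kisym.
rewrite raddfD /= -/Ki -/a (mulmxA (u x)^T) -aT mulmxBr raddfB /= addrA (mulmxA _ dK).
by rewrite -[\tr (a^T *m du)]mxtrace_tr trmx_mul trmxK mulr_natl mulr2n.
Qed.

Variables (c : R -> R) (lc : R).
Hypothesis hc : is_derive (t x) 1 c (lc * c (t x)).
Hypothesis c_neq0 : c (t x) != 0.

Let D y := Num.sqrt (\det (K y)) / c (t y).

(** This is logarithmic differentiation: the square root of the determinant contributes half the
    trace of [Ki *m dK], and the factor [1 / c] contributes [- lc * dt]. *)
Lemma is_derive_density :
  is_derive x v D (D x * (\tr (Ki *m dK) / 2 - lc * dt)).
Proof.
have h1 := is_derive_comp_real (is_derive_det hK) (is_derive1_sqrt detK_gt0).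
have h2 := is_derive_inv (f := fun y => c (t y)) c_neq0 (is_derive_comp_real ht hc).
apply: (is_derive_eq (is_derive_mul h1 h2)).
rewrite /D (adj_unitmx unitmx_det_gt0) -scalemxAl mxtraceZ -/Ki.
have s0 : 0 < Num.sqrt (\det (K x)) by rewrite sqrtr_gt0.
(* The determinant is written as the square of its root, so that [field] can cancel the root. *)
rewrite -{2}(sqr_sqrtr (ltW detK_gt0)).
by field; rewrite c_neq0 (gt_eqF s0).
Qed.

Let s y := 1 - t y + \tr ((u y)^T *m (invmx (K y) *m u y)).
Let ds := - dt + 2 * \tr (du^T *m a) - \tr (a^T *m dK *m a).

Lemma is_derive_sfrak : is_derive x v s ds.
Proof.
apply: (is_derive_eq (is_derive_add (is_derive_sub (is_derive_const (1 : R) x v) ht)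
  is_derive_quad)).
by rewrite sub0r addrA.
Qed.

Variables (r r1 r2 : R -> R).
Hypothesis hr : is_derive (s x) 1 r (r1 (s x)).
Hypothesis hr1 : is_derive (s x) 1 r1 (r2 (s x)).

Lemma is_derive_volume_element :
  is_derive x v (fun y => r (s y) / c (t y) * Num.sqrt (\det (K y)))
    (D x * (r1 (s x) * ds + r (s x) * (\tr (Ki *m dK) / 2 - lc * dt))).
Proof.
rewrite (_ : (fun _ => _) = fun y => D y * r (s y)).
  apply: (is_derive_eq (is_derive_mul is_derive_density
    (is_derive_comp_real is_derive_sfrak hr))).
  by ring.
by apply/funext => y; rewrite /D; ring.
Qed.

(** In the intended reading, [2 * phi] is the variation of [s] in a jet direction and [psi] is half
    the trace of [K^-1] times the variation of [K]; the symmetric halves have been merged. *)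
Let phi y := \tr ((m y)^T *m (invmx (K y) *m u y))
  - \tr ((invmx (K y) *m u y)^T *m L y *m (invmx (K y) *m u y)).
Let psi y := \tr (invmx (K y) *m L y).
Let da := Ki *m (du - dK *m a).
Let dphi := \tr (dm^T *m a) + \tr ((m x)^T *m da)
  - (\tr (da^T *m L x *m a) + \tr (a^T *m dL *m a) + \tr (a^T *m L x *m da)).
Let dpsi := \tr (Ki *m dL) - \tr (Ki *m dK *m Ki *m L x).

(** The function differentiated is the first jet variation of the volume element, so this is the
    source of all second derivatives of F. *)
Lemma is_derive_volume_element1 :
  is_derive x v
    (fun y => D y * (2 * (r1 (s y) * phi y) + r (s y) * psi y))
    (D x * ((\tr (Ki *m dK) / 2 - lc * dt) *
              (2 * (r1 (s x) * phi x) + r (s x) * psi x)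
            + 2 * (r2 (s x) * ds * phi x + r1 (s x) * dphi)
            + (r1 (s x) * ds * psi x + r (s x) * dpsi))).
Proof.
have hphi : is_derive x v phi dphi.
  apply: (is_derive_eq (is_derive_sub
    (is_derive_mxtrace (is_derive_mulmx (is_derive_trmx hm) is_derive_solve))
    (is_derive_mxtrace (is_derive_mulmx (is_derive_mulmx
      (is_derive_trmx is_derive_solve) hL) is_derive_solve)))).
  by rewrite mulmxDl !mxtraceD.
have hpsi : is_derive x v psi dpsi.
  apply: (is_derive_eq (is_derive_mxtrace
    (is_derive_mulmx (is_derive_invmx unitmx_det_gt0 hK) hL))).
  by rewrite raddfD /= addrC mulNmx raddfN.
apply: (is_derive_eq (is_derive_mul is_derive_density (is_derive_add
  (is_derive_mul (is_derive_const (2 : R) x v)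
    (is_derive_mul (is_derive_comp_real is_derive_sfrak hr1) hphi))
  (is_derive_mul (is_derive_comp_real is_derive_sfrak hr) hpsi)))).
by ring.
Qed.

End Variations.


Lemma mxtrace_mulE (R : pzRingType) m n (A : 'M[R]_(m, n)) (B : 'M[R]_(n, m)) :
  \tr (A *m B) = \sum_j \sum_i A i j * B j i.
Proof.
rewrite exchange_big; apply: eq_bigr => i _; rewrite mxE.
by apply: eq_bigr.
Qed.

Lemma mxtrace_mul_delta (R : pzRingType) m n (A : 'M[R]_(m, n)) g i :
  \tr (A *m delta_mx g i) = A i g.
Proof.
rewrite mxtrace_mulE (bigD1 g) //= (bigD1 i) //= mxE !eqxx mulr1.
rewrite !big1 ?addr0 // => j jn; last by rewrite mxE (negPf jn) andbF mulr0.
by apply: big1 => k _; rewrite mxE (negPf jn) mulr0.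
Qed.

Lemma mxtraceN (R : pzRingType) n (A : 'M[R]_n) : \tr (- A) = - \tr A.
Proof. exact: raddfN. Qed.

Lemma mxtraceB (R : pzRingType) n (A B : 'M[R]_n) : \tr (A - B) = \tr A - \tr B.
Proof. exact: raddfB. Qed.

(** * Tangential and normal parts: linear algebra of the variations *)

Section Algebra.
Context {R : realType} (N n : nat).
Variables (H : 'M[R]_N) (z : 'M[R]_(N, n)) (w : 'cV[R]_N).
Hypotheses (Hsym : H^T = H) (Ku : z^T *m H *m z \in unitmx).

(* In the paper's notation: [Kinv] = h^{ij}, [Amx] = A^{i alpha}, [tang] = A^{i alpha} W_alpha,
   [nrm] = W_tau (delta^tau_gamma - B^tau_gamma), [Qmx] = h~_{gamma eta} - B_{gamma eta}.
   They are locked because [trmx_mul] and [mulmxA] would otherwise rewrite inside them. *)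
Definition Kinv := locked (invmx (z^T *m H *m z)).
Definition Amx := locked (Kinv *m z^T).
Definition tang := locked (Amx *m w).
Definition nrm := locked (w - H *m z *m tang).
Definition Qmx := locked (H - H *m z *m Amx *m H).
Lemma KinvE : Kinv = invmx (z^T *m H *m z). Proof. by rewrite /Kinv -lock. Qed.
Lemma AmxE : Amx = Kinv *m z^T. Proof. by rewrite /Amx -lock. Qed.
Lemma tangE : tang = Amx *m w. Proof. by rewrite /tang -lock. Qed.
Lemma nrmE : nrm = w - H *m z *m tang. Proof. by rewrite /nrm -lock. Qed.
Lemma QmxE : Qmx = H - H *m z *m Amx *m H. Proof. by rewrite /Qmx -lock. Qed.
Lemma tang_solve : invmx (z^T *m H *m z) *m (z^T *m w) = tang.
Proof. by rewrite tangE AmxE KinvE mulmxA. Qed.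

Lemma K_sym : (z^T *m H *m z)^T = z^T *m H *m z.
Proof. by rewrite !trmx_mul trmxK Hsym mulmxA. Qed.

Lemma Kinv_sym : Kinv^T = Kinv.
Proof. by rewrite KinvE trmx_inv K_sym. Qed.

Lemma mulVK : Kinv *m (z^T *m (H *m z)) = 1%:M.
Proof. by rewrite KinvE (mulmxA z^T) mulVmx. Qed.
Local Notation Ki := Kinv.
Local Notation A := Amx.
Local Notation a := tang.
Local Notation nu := nrm.
Local Notation Q := Qmx.

Lemma Amx_tr : A^T = z *m Ki.
Proof. by rewrite AmxE trmx_mul trmxK Kinv_sym. Qed.

Lemma Qmx_sym : Q^T = Q.
Proof.
by rewrite QmxE AmxE linearB /= !trmx_mul trmxK Kinv_sym Hsym !mulmxA.
Qed.

Lemma nrm_tr : nu^T = w^T - a^T *m z^T *m H.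
Proof. by rewrite nrmE linearB /= !trmx_mul Hsym !mulmxA. Qed.

Lemma Amx_z : A *m (H *m z) = 1%:M.
Proof. by rewrite AmxE -mulmxA mulVK. Qed.

(** [Qmx] is the metric minus its tangential part. This identity and [nrm_z] are what later removes
    the Christoffel symbols of the induced metric. *)
Lemma Qmx_z : Q *m z = 0.
Proof. by rewrite QmxE mulmxBl -!mulmxA Amx_z mulmx1 subrr. Qed.

Lemma nrm_z : nu^T *m z = 0.
Proof.
rewrite nrm_tr tangE trmx_mul Amx_tr mulmxBl -!mulmxA mulVK.
by rewrite mulmx1 subrr.
Qed.

Section FirstVariation.
Variables (X : 'M[R]_(N, n)) (om : 'cV[R]_N).
Let dK := X^T *m H *m z + z^T *m H *m X.
Let du := X^T *m w + z^T *m om.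

(** The two summands of [dK] are transposes of each other and have equal trace against the symmetric
    [Ki]. *)
Lemma trace_dK : \tr (Ki *m dK) / 2 = \tr (A *m H *m X).
Proof.
have E : \tr (Ki *m (X^T *m H *m z)) = \tr (A *m H *m X).
  rewrite -mxtrace_tr !trmx_mul trmxK Hsym Kinv_sym mxtrace_mulC AmxE.
  by rewrite !mulmxA.
by rewrite mulmxDr mxtraceD E AmxE !mulmxA; field.
Qed.

(** The terms [X^T *m w] and [X^T *m H *m z *m a] combine into [X^T *m nu]: apart from the reaction
    of the metric on [a], only the normal part of [w] feels the motion of the tangent plane. *)
Lemma dsolve : Ki *m (du - dK *m a) = Ki *m X^T *m nu + A *m om - A *m H *m X *m a.
Proof.
rewrite /du /dK nrmE AmxE !(mulmxDl, mulmxDr, mulmxBr, mulmxBl, mulmxN, mulNmx).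
by rewrite !mulmxA opprD !addrA; congr (_ - _); rewrite addrAC.
Qed.

Lemma dquad : 2 * \tr (du^T *m a) - \tr (a^T *m dK *m a) =
  2 * \tr (om^T *m (z *m a)) + 2 * \tr (nu^T *m X *m a).
Proof.
have E : \tr (a^T *m (X^T *m H *m z) *m a) = \tr (a^T *m z^T *m H *m X *m a).
  by rewrite -mxtrace_tr !trmx_mul !trmxK Hsym !mulmxA.
rewrite /du /dK nrm_tr linearD /= !trmx_mul !trmxK.
rewrite !(mulmxDl, mulmxDr, mulNmx, mulmxN) !(mxtraceD, mxtraceN) E !mulmxA.
by ring.
Qed.

End FirstVariation.

Section SecondVariation.
Variables (X W Y : 'M[R]_(N, n)) (om : 'cV[R]_N).
Let dK := X^T *m H *m z + z^T *m H *m X.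
Let du := X^T *m w + z^T *m om.
Let dm := Y^T *m w + W^T *m om.
Let L := z^T *m H *m W.
Let dL := X^T *m H *m W + z^T *m H *m Y.
Let m := W^T *m w.
Let da := Ki *m (du - dK *m a).

Lemma phiE : \tr (m^T *m a) - \tr (a^T *m L *m a) = \tr (nu^T *m W *m a).
Proof.
by rewrite /m trmx_mul trmxK -mxtraceB nrm_tr !mulmxBl !mulmxA.
Qed.

(** The contributions are grouped by what varies: [E1] varies [m] and [L] with [a] fixed, while [E2]
    to [E4] vary the two occurrences of [a]. *)
Lemma dphiE :
  \tr (dm^T *m a) + \tr (m^T *m da)
  - (\tr (da^T *m L *m a) + \tr (a^T *m dL *m a) + \tr (a^T *m L *m da)) =
  \tr (nu^T *m Y *m a) + \tr (om^T *m W *m a) - \tr (om^T *m z *m A *m H *m W *m a)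
  + \tr (nu^T *m W *m A *m om) + \tr (nu^T *m W *m Ki *m X^T *m nu)
  - \tr (nu^T *m W *m A *m H *m X *m a) - \tr (nu^T *m X *m A *m H *m W *m a)
  - \tr (a^T *m X^T *m Q *m W *m a).
Proof.
have E1 : \tr (dm^T *m a) - \tr (a^T *m dL *m a) =
    \tr (nu^T *m Y *m a) + \tr (om^T *m W *m a) - \tr (a^T *m X^T *m H *m W *m a).
  rewrite /dm /dL nrm_tr linearD /= !trmx_mul !trmxK.
  rewrite !(mulmxDl, mulmxDr, mulNmx, mulmxN) !(mxtraceD, mxtraceN) !mulmxA.
  by ring.
have E2 : \tr (m^T *m da) - \tr (a^T *m L *m da) = \tr (nu^T *m W *m da).
  by rewrite /m trmx_mul trmxK -mxtraceB nrm_tr /L !mulmxBl !mulmxA.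
have E3 : \tr (nu^T *m W *m da) = \tr (nu^T *m W *m Ki *m X^T *m nu)
    + \tr (nu^T *m W *m A *m om) - \tr (nu^T *m W *m A *m H *m X *m a).
  rewrite /da dsolve !(mulmxDl, mulmxDr, mulNmx, mulmxN) !(mxtraceD, mxtraceN) !mulmxA.
  by [].
(* The tangential part of [H] is written as [H - Q]; its [H] term cancels the one left over in [E1],
   so only [Q] survives. *)
have E4 : \tr (da^T *m L *m a) = \tr (nu^T *m X *m A *m H *m W *m a)
    + \tr (om^T *m z *m A *m H *m W *m a)
    - (\tr (a^T *m X^T *m H *m W *m a) - \tr (a^T *m X^T *m Q *m W *m a)).
  have daT : da^T = nu^T *m X *m Ki + om^T *m A^T - a^T *m X^T *m H *m A^T.
    rewrite /da dsolve linearB /= linearD /= !trmx_mul trmxK.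
    by rewrite Kinv_sym Hsym !mulmxA.
  rewrite daT /L QmxE Amx_tr AmxE !(mulmxDl, mulmxDr, mulNmx, mulmxN) !(mxtraceD, mxtraceN) !mulmxA.
  by ring.
have assoc5 (p q r s t : R) : p + q - (r + s + t) = (p - s) + (q - t) - r.
  by ring.
rewrite assoc5 E1 E2 E3 E4.
by ring.
Qed.

Lemma dpsiE :
  \tr (Ki *m dL) - \tr (Ki *m dK *m Ki *m L) =
  \tr (A *m H *m Y) + \tr (Ki *m X^T *m Q *m W) - \tr (A *m H *m X *m A *m H *m W).
Proof.
rewrite /dL /dK /L QmxE AmxE !(mulmxDl, mulmxDr, mulNmx, mulmxN) !(mxtraceD, mxtraceN) !mulmxA.
by ring.
Qed.

End SecondVariation.
End Algebra.


Lemma trmxD (R : nmodType) m n (A B : 'M[R]_(m, n)) : (A + B)^T = A^T + B^T.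
Proof. exact: raddfD. Qed.

(** * The volume density as a function of metric, covector, norm and jet *)

Section Density.
Context {R : realType} (N n : nat).
Implicit Types (H : 'M[R]_N) (w om : 'cV[R]_N) (z W : 'M[R]_(N, n)) (t : R).
Variables (r r1 r2 c : R -> R).

(* [navs] is the paper's fraktur s and [dens] its calligraphic F. *)
Definition navs H w t z : R :=
  1 - t + \tr ((z^T *m w)^T *m (invmx (z^T *m H *m z) *m (z^T *m w))).

Definition dens H w t z : R :=
  r (navs H w t z) / c t * Num.sqrt (\det (z^T *m H *m z)).

(** Closed form of the derivative of [dens] in the jet direction [W], the other arguments being
    frozen; [is_derive_calF_jet] proves this for the Randers data. *)
Definition dens1 W H w t z : R :=
  let a := invmx (z^T *m H *m z) *m (z^T *m w) in
  let L := z^T *m H *m W in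
  Num.sqrt (\det (z^T *m H *m z)) / c t *
  (2 * (r1 (navs H w t z) * (\tr ((W^T *m w)^T *m a) - \tr (a^T *m L *m a)))
   + r (navs H w t z) * \tr (invmx (z^T *m H *m z) *m L)).

Context {V : normedModType R} (x v : V).
Variables (H : V -> 'M[R]_N) (w : V -> 'cV[R]_N) (t : V -> R) (z : V -> 'M[R]_(N, n)).
(** One setting serves two uses: [Gam] and [om] zero with [dz] free give a variation of the jet,
    while [dz] zero with [Gam] the connection matrix gives a displacement of the base point. *)
Variables (Gam : 'M[R]_N) (om : 'cV[R]_N) (dt : R) (dz : 'M[R]_(N, n)).
Hypotheses (dH : is_derive x v H (Gam^T *m H x + H x *m Gam))
  (dw : is_derive x v w (om + Gam^T *m w x)) (dtx : is_derive x v t dt)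
  (dzx : is_derive x v z dz).
Hypotheses (Hsym : (H x)^T = H x) (det_gt0 : 0 < \det ((z x)^T *m H x *m z x)).
Let s := navs (H x) (w x) (t x) (z x).
Variable lc : R.
Hypotheses (dc : is_derive (t x) 1 c (lc * c (t x))) (c_neq0 : c (t x) != 0).
Hypotheses (dr : is_derive s 1 r (r1 s)) (dr1 : is_derive s 1 r1 (r2 s)).

Let X := dz + Gam *m z x.
Let A := Amx (H x) (z x).
Let Ki := Kinv (H x) (z x).
Let a := tang (H x) (z x) (w x).
Let nu := nrm (H x) (z x) (w x).
Let Q := Qmx (H x) (z x).
Let D := Num.sqrt (\det ((z x)^T *m H x *m z x)) / c (t x).
Let ds := - dt + 2 * \tr (om^T *m (z x *m a)) + 2 * \tr (nu^T *m X *m a).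

Lemma gram_unit : (z x)^T *m H x *m z x \in unitmx.
Proof. by rewrite unitmxE unitfE gt_eqF. Qed.

Let dK : is_derive x v (fun y => (z y)^T *m H y *m z y)
  (X^T *m H x *m z x + (z x)^T *m H x *m X).
Proof.
apply: (is_derive_eq (is_derive_mulmx (is_derive_mulmx (is_derive_trmx dzx) dH) dzx)).
rewrite /X trmxD trmx_mul !(mulmxDl, mulmxDr) !mulmxA -!addrA; congr (_ + _).
by congr (_ + _); rewrite addrC.
Qed.

Let du : is_derive x v (fun y => (z y)^T *m w y) (X^T *m w x + (z x)^T *m om).
Proof.
apply: (is_derive_eq (is_derive_mulmx (is_derive_trmx dzx) dw)).
rewrite /X trmxD trmx_mul !(mulmxDl, mulmxDr) !mulmxA -!addrA; congr (_ + _).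
by rewrite addrC.
Qed.

Let dnavs : - dt + 2 * \tr ((X^T *m w x + (z x)^T *m om)^T *m a)
    - \tr (a^T *m (X^T *m H x *m z x + (z x)^T *m H x *m X) *m a) = ds.
Proof. by rewrite -addrA dquad // addrA. Qed.

Lemma is_derive_navs : is_derive x v (fun y => navs (H y) (w y) (t y) (z y)) ds.
Proof.
apply: (is_derive_eq (is_derive_sfrak dK du dtx (K_sym _ Hsym) det_gt0)).
by rewrite tang_solve -/a dnavs.
Qed.

Lemma is_derive_dens :
  is_derive x v (fun y => dens (H y) (w y) (t y) (z y))
    (D * (r1 s * ds + r s * (\tr (A *m H x *m X) - lc * dt))).
Proof.
apply: (is_derive_eq (is_derive_volume_element dK du dtx (K_sym _ Hsym) det_gt0
   dc c_neq0 dr)).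
by rewrite -/(navs (H x) (w x) (t x) (z x)) -/s tang_solve -/a dnavs -KinvE trace_dK.
Qed.

(** The direction [W] is constant in coordinates, so it contributes its covariant variation
    [Gam *m W], named [Y]. *)
Lemma is_derive_dens1 W :
  let phi := \tr (nu^T *m W *m a) in
  let psi := \tr (A *m H x *m W) in
  let Y := Gam *m W in
  let dphi := \tr (nu^T *m Y *m a) + \tr (om^T *m W *m a)
    - \tr (om^T *m z x *m A *m H x *m W *m a)
    + \tr (nu^T *m W *m A *m om) + \tr (nu^T *m W *m Ki *m X^T *m nu)
    - \tr (nu^T *m W *m A *m H x *m X *m a)
    - \tr (nu^T *m X *m A *m H x *m W *m a)
    - \tr (a^T *m X^T *m Q *m W *m a) in
  let dpsi := \tr (A *m H x *m Y) + \tr (Ki *m X^T *m Q *m W)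
    - \tr (A *m H x *m X *m A *m H x *m W) in
  is_derive x v (fun y => dens1 W (H y) (w y) (t y) (z y))
    (D * ((\tr (A *m H x *m X) - lc * dt) * (2 * (r1 s * phi) + r s * psi)
          + 2 * (r2 s * ds * phi + r1 s * dphi)
          + (r1 s * ds * psi + r s * dpsi))).
Proof.
move=> phi psi Y dphi dpsi.
have dL : is_derive x v (fun y => (z y)^T *m H y *m W)
    (X^T *m H x *m W + (z x)^T *m H x *m Y).
  apply: (is_derive_eq (is_derive_mulmx (is_derive_mulmx (is_derive_trmx dzx) dH)
    (is_derive_const W x v))).
  rewrite /X /Y trmxD trmx_mul mulmx0 addr0 !(mulmxDl, mulmxDr) !mulmxA.
  by rewrite !addrA.
have dm : is_derive x v (fun y => W^T *m w y) (Y^T *m w x + W^T *m om).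
  apply: (is_derive_eq (is_derive_mulmx (is_derive_const W^T x v) dw)).
  by rewrite mul0mx add0r mulmxDr /Y trmx_mul mulmxA addrC.
apply: (is_derive_eq (is_derive_volume_element1 dK dL du dm dtx (K_sym _ Hsym) det_gt0
  dc c_neq0 dr dr1)).
rewrite -/(navs (H x) (w x) (t x) (z x)) -/s tang_solve -/a dnavs -KinvE.
rewrite trace_dK // phiE // dphiE // ?gram_unit // dpsiE //.
suff -> : \tr (Kinv (H x) (z x) *m ((z x)^T *m H x *m W)) = psi by [].
by rewrite /psi /A AmxE !mulmxA.
Qed.

End Density.

(** * Coordinate expressions *)


Section Entries.
Context {R : comPzRingType}.

(** The sums are ordered so that the coefficient of the entry [X e j] can be read off; all
    coordinate formulas below are compared coefficient by coefficient in [X]. *)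
Lemma mulmx3E m n p q (P : 'M[R]_(m, n)) (X : 'M[R]_(n, p)) (S : 'M[R]_(p, q)) i g :
  (P *m X *m S) i g = \sum_e \sum_j P i e * S j g * X e j.
Proof.
rewrite mxE exchange_big; apply: eq_bigr => j _; rewrite mxE mulr_suml.
by apply: eq_bigr => e _; rewrite mulrAC.
Qed.

Lemma mulmx3trE m n p q (P : 'M[R]_(m, n)) (X : 'M[R]_(p, n)) (S : 'M[R]_(p, q)) i g :
  (P *m X^T *m S) i g = \sum_e \sum_j P i j * S e g * X e j.
Proof.
rewrite mulmx3E exchange_big; apply: eq_bigr => e _; apply: eq_bigr => j _.
by rewrite mxE.
Qed.

Lemma trace_row_delta_col m n (p : 'rV[R]_m) (q : 'cV[R]_n) g i :
  \tr (p *m delta_mx g i *m q) = p 0 g * q i 0.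
Proof.
by rewrite mxtrace_mulC mulmxA mxtrace_mul_delta mxE big_ord1 mulrC.
Qed.

Lemma sumDZ (I J : finType) (k : R) (f h : I -> J -> R) :
  \sum_e \sum_j (k * f e j + h e j) =
  k * (\sum_e \sum_j f e j) + \sum_e \sum_j h e j.
Proof.
rewrite mulr_sumr -big_split; apply: eq_bigr => e _.
by rewrite mulr_sumr -big_split.
Qed.

Lemma sumZ (I J : finType) (k : R) (f : I -> J -> R) :
  \sum_e \sum_j k * f e j = k * \sum_e \sum_j f e j.
Proof. by rewrite mulr_sumr; apply: eq_bigr => e _; rewrite mulr_sumr. Qed.

End Entries.

Section Coordinates.
Context {R : realType} (N n : nat).
Variables (H : 'M[R]_N) (z : 'M[R]_(N, n)) (w : 'cV[R]_N).
Hypotheses (Hsym : H^T = H) (Ku : z^T *m H *m z \in unitmx).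
Variables (r0 r1 r2 : R).

Local Notation Ki := (Kinv H z).
Local Notation A := (Amx H z).
Local Notation a := (tang H z w).
Local Notation nu := (nrm H z w).
Local Notation Q := (Qmx H z).
Local Notation AH := (A *m H).

(** Up to the common factor [D], the partial derivative of F with respect to the jet entry [z e j];
    [d2F_coef] plays the same role for second derivatives. *)
Definition dF_coef e j := 2 * r1 * nu e 0 * a j 0 + r0 * AH j e.

Definition d2F_coef g i e j :=
  r0 * AH i g * AH j e + 2 * r1 * (AH i g * nu e 0 * a j 0 + nu g 0 * a i 0 * AH j e)
  + 4 * r2 * nu g 0 * a i 0 * nu e 0 * a j 0
  + 2 * r1 * (- (a i 0 * a j 0 * Q g e) - nu g 0 * AH i e * a j 0
              - nu e 0 * a i 0 * AH j g + nu g 0 * nu e 0 * Ki i j)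
  + r0 * (Ki i j * Q g e - AH i e * AH j g).

(** The symmetry of second derivatives is visible in the formula, since [Q] and [Ki] are symmetric.
    It reconciles the order of differentiation in [Hmean] with that of the computation. *)
Lemma d2F_coefC g i e j : d2F_coef g i e j = d2F_coef e j g i.
Proof.
have QC : Q g e = Q e g by rewrite -[in LHS](Qmx_sym z Hsym) mxE.
have KC : Ki i j = Ki j i by rewrite -[in LHS](Kinv_sym z Hsym) mxE.
by rewrite /d2F_coef QC KC; ring.
Qed.

Lemma first_variationE (X : 'M[R]_(N, n)) :
  2 * (r1 * \tr (nu^T *m X *m a)) + r0 * \tr (AH *m X) =
  \sum_e \sum_j dF_coef e j * X e j.
Proof.
rewrite trace_mx11 mulmx3E mxtrace_mulE mulrA -(sumZ r0) -sumDZ.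
apply: eq_bigr => e _; apply: eq_bigr => j _.
by rewrite /dF_coef mxE; ring.
Qed.

Lemma sum_d2F_coef g i (X : 'M[R]_(N, n)) :
  \sum_e \sum_j d2F_coef g i e j * X e j =
    (r0 * AH i g + 2 * r1 * nu g 0 * a i 0) * \tr (AH *m X)
    + (2 * r1 * AH i g + 4 * r2 * nu g 0 * a i 0) * \tr (nu^T *m X *m a)
    + 2 * r1 * (nu g 0 * (Ki *m X^T *m nu) i 0
      - nu g 0 * (AH *m X *m a) i 0 - (nu^T *m X *m AH) 0 g * a i 0
      - (a^T *m X^T *m Q) 0 g * a i 0)
    + r0 * ((Ki *m X^T *m Q) i g - (AH *m X *m AH) i g).
Proof.
have QC e : Q g e = Q e g by rewrite -[in LHS](Qmx_sym z Hsym) mxE.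
have eT : \tr (AH *m X) = \sum_e \sum_j AH j e * X e j by rewrite mxtrace_mulE.
have eF : \tr (nu^T *m X *m a) = \sum_e \sum_j nu e 0 * a j 0 * X e j.
  rewrite trace_mx11 mulmx3E; apply: eq_bigr => e _; apply: eq_bigr => j _.
  by rewrite mxE.
have e3 : (nu^T *m X *m AH) 0 g = \sum_e \sum_j nu e 0 * AH j g * X e j.
  rewrite mulmx3E; apply: eq_bigr => e _; apply: eq_bigr => j _.
  by rewrite [_^T _ _]mxE.
have e1 : (a^T *m X^T *m Q) 0 g = \sum_e \sum_j a j 0 * Q e g * X e j.
  rewrite mulmx3trE; apply: eq_bigr => e _; apply: eq_bigr => j _.
  by rewrite mxE.
rewrite eT eF e3 e1 !mulmx3trE !mulmx3E.
(* The summand is split into eight monomials, one for each matrix product on the right, so that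
   [sumDZ] can extract the constants. *)
transitivity (\sum_e \sum_j
  ((r0 * AH i g + 2 * r1 * nu g 0 * a i 0) * (AH j e * X e j)
  + ((2 * r1 * AH i g + 4 * r2 * nu g 0 * a i 0) * (nu e 0 * a j 0 * X e j)
  + (2 * r1 * nu g 0 * (Ki i j * nu e 0 * X e j)
  + (- (2 * r1 * nu g 0) * (AH i e * a j 0 * X e j)
  + (- (2 * r1 * a i 0) * (nu e 0 * AH j g * X e j)
  + (- (2 * r1 * a i 0) * (a j 0 * Q e g * X e j)
  + (r0 * (Ki i j * Q e g * X e j)
  + - r0 * (AH i e * AH j g * X e j))))))))).
  apply: eq_bigr => e _; apply: eq_bigr => j _.
  by rewrite /d2F_coef QC; ring.
rewrite !sumDZ sumZ.
by ring.
Qed.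

Variables (X : 'M[R]_(N, n)) (Gam : 'M[R]_N) (om : 'cV[R]_N) (dt lc : R).
Variables (g : 'I_N) (i : 'I_n).

(** For an elementary direction the second variation separates into a part linear in [X], a part
    from the connection acting on the direction, and a remainder containing only [om] and [dt]. Here
    [sigma] is the share of [ds] free of [X]. *)
Lemma second_variationE :
  let W := delta_mx g i : 'M[R]_(N, n) in
  let sigma := - dt + 2 * \tr (om^T *m (z *m a)) in
  let ds := sigma + 2 * \tr (nu^T *m X *m a) in
  let phi := \tr (nu^T *m W *m a) in
  let psi := \tr (AH *m W) in
  let Y := Gam *m W in
  let dphi := \tr (nu^T *m Y *m a) + \tr (om^T *m W *m a)
    - \tr (om^T *m z *m A *m H *m W *m a)
    + \tr (nu^T *m W *m A *m om) + \tr (nu^T *m W *m Ki *m X^T *m nu)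
    - \tr (nu^T *m W *m A *m H *m X *m a)
    - \tr (nu^T *m X *m A *m H *m W *m a)
    - \tr (a^T *m X^T *m Q *m W *m a) in
  let dpsi := \tr (A *m H *m Y) + \tr (Ki *m X^T *m Q *m W)
    - \tr (A *m H *m X *m A *m H *m W) in
  (\tr (AH *m X) - lc * dt) * (2 * (r1 * phi) + r0 * psi)
    + 2 * (r2 * ds * phi + r1 * dphi) + (r1 * ds * psi + r0 * dpsi) =
  \sum_e \sum_j d2F_coef g i e j * X e j + \sum_e dF_coef e i * Gam e g
  + (- lc * dt * dF_coef g i + 2 * r2 * sigma * nu g 0 * a i 0
     + 2 * r1 * ((om^T *m (1%:M - z *m AH)) 0 g * a i 0 + nu g 0 * (A *m om) i 0)
     + r1 * sigma * AH i g).
Proof.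
move=> W sigma ds phi psi Y dphi dpsi.
have eG : \sum_e dF_coef e i * Gam e g =
    2 * r1 * a i 0 * (nu^T *m Gam) 0 g + r0 * (AH *m Gam) i g.
  rewrite [(nu^T *m Gam) 0 g]mxE [(AH *m Gam) i g]mxE !mulr_sumr -big_split.
  by apply: eq_bigr => e _; rewrite /dF_coef [nu^T _ _]mxE /=; ring.
have eO : (om^T *m (1%:M - z *m AH)) 0 g = om g 0 - (om^T *m z *m A *m H) 0 g.
  by rewrite mulmxBr mulmx1 !mulmxA !mxE.
have tW (P : 'rV[R]_N) (q : 'cV[R]_n) : \tr (P *m W *m q) = P 0 g * q i 0.
  exact: trace_row_delta_col.
have nT : nu g 0 = nu^T 0 g by rewrite mxE.
have e1 : \tr (nu^T *m W *m A *m om) = nu g 0 * (A *m om) i 0.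
  by rewrite nT -tW !mulmxA.
have e2 : \tr (nu^T *m W *m Ki *m X^T *m nu) = nu g 0 * (Ki *m X^T *m nu) i 0.
  by rewrite nT -tW !mulmxA.
have e3 : \tr (nu^T *m W *m A *m H *m X *m a) = nu g 0 * (AH *m X *m a) i 0.
  by rewrite nT -tW !mulmxA.
rewrite eG eO sum_d2F_coef /dphi /dpsi /phi /psi /Y /ds !mulmxA e1 e2 e3 !tW.
rewrite !mxtrace_mul_delta -nT [om^T 0 g]mxE /dF_coef.
by ring.
Qed.

End Coordinates.

(** * Derivatives of the Randers volume form *)


Section Navigation.
Context {R : realType} (n p : nat).
Local Notation N := (n + p)%N.
Variables (ht : 'I_N -> 'I_N -> 'rV[R]_N -> R) (Wt : 'I_N -> 'rV[R]_N -> R).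
Variable Ut : set 'rV[R]_N.
Hypotheses (oUt : open Ut) (ht_smooth : forall a b, smooth_on Ut (ht a b))
  (Wt_smooth : forall a, smooth_on Ut (Wt a))
  (ht_sym : forall a b y, Ut y -> ht a b y = ht b a y)
  (ht_pos : forall y, Ut y -> forall v : 'rV[R]_N,
      v != 0 -> 0 < (v *m hmat ht y *m v^T) 0 0)
  (Wt_lt1 : forall y, Ut y -> Wnorm2 ht Wt y < 1).
Implicit Types (y : 'rV[R]_N) (z : 'M[R]_(N, n)).

Let H y := hmat ht y.
Definition Wcol y : 'cV[R]_N := \col_a Wt a y.
Definition wcol y : 'cV[R]_N := (Wlow ht Wt y)^T.
(** Connection matrix in direction [e]: adding its action to the coordinate derivative gives the
    covariant derivative of a vector. *)
Definition Gmat (e : 'I_N) y : 'M[R]_N := \matrix_(b, a) Gt ht b e a y.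
Definition Wcov (e : 'I_N) y : 'cV[R]_N := \col_a Wlowcov ht Wt a e y.

Lemma hmat_sym y : Ut y -> (H y)^T = H y.
Proof. by move=> Uy; apply/matrixP => a b; rewrite !mxE ht_sym. Qed.

Lemma hmat_unit y : Ut y -> H y \in unitmx.
Proof. by move=> Uy; apply: posdef_unitmx; exact: ht_pos. Qed.

Lemma wcolE y : wcol y = H y *m Wcol y.
Proof.
by apply/colP => a; rewrite !mxE; apply: eq_bigr => b _; rewrite !mxE.
Qed.

Lemma Wnorm2E y : Wnorm2 ht Wt y = \tr ((Wcol y)^T *m H y *m Wcol y).
Proof.
rewrite trace_mx11 mulmx3E; apply: eq_bigr => a _; apply: eq_bigr => b _.
by rewrite !mxE; ring.
Qed.

Lemma derivable_ht a b y v : Ut y -> derivable (ht a b) y v.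
Proof. by move=> Uy; have [_ /(_ y v Uy)] := ht_smooth a b [::]. Qed.

Lemma derivable_Wt a y v : Ut y -> derivable (Wt a) y v.
Proof. by move=> Uy; have [_ /(_ y v Uy)] := Wt_smooth a [::]. Qed.

Lemma derive_ht_sym a b y v : Ut y -> 'D_v (ht a b) y = 'D_v (ht b a) y.
Proof.
move=> Uy; apply: near_eq_derive.
have : \forall y' \near y, Ut y' by exact: open_nbhs_nbhs.
by apply: filterS => y' Uy'; exact: ht_sym.
Qed.

Lemma Gt_sym a b c y : Ut y -> Gt ht a b c y = Gt ht a c b y.
Proof.
move=> Uy; rewrite /Gt; congr (_ * _); apply: eq_bigr => m _.
by rewrite (derive_ht_sym b c _ Uy); congr (_ * (_ - _)); rewrite addrC.
Qed.

(** Lowering the index cancels the inverse metric and leaves Christoffel symbols of the first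
    kind. *)
Lemma hmat_Gmat e y a b : Ut y -> (H y *m Gmat e y) a b =
  2^-1 * ('D_(ev e) (ht a b) y + 'D_(ev b) (ht a e) y - 'D_(ev a) (ht e b) y).
Proof.
move=> Uy.
pose C : 'M[R]_N := \matrix_(m, c) (2^-1 *
  ('D_(ev e) (ht m c) y + 'D_(ev c) (ht m e) y - 'D_(ev m) (ht e c) y)).
have -> : Gmat e y = invmx (H y) *m C.
  apply/matrixP => i j; rewrite !mxE /Gt mulr_sumr; apply: eq_bigr => m _.
  by rewrite [C _ _]mxE; ring.
by rewrite mulKVmx ?hmat_unit // mxE.
Qed.

(** Metric compatibility of the Levi-Civita connection: in the sum of two first-kind symbols all
    derivatives but one cancel. *)
Lemma is_derive_hmat e y : Ut y ->
  is_derive y (ev e) H ((Gmat e y)^T *m H y + H y *m Gmat e y).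
Proof.
move=> Uy; apply/is_derive_mxP => a b.
rewrite (_ : (fun _ => _) = ht a b); last by apply/funext => y'; rewrite mxE.
apply: (is_derive_eq (derivableP (@derivable_ht a b y (ev e) Uy))).
rewrite mxE -[X in X *m H y]trmxK trmxK -{1}(hmat_sym Uy) -trmx_mul [(_^T) a b]mxE.
rewrite !hmat_Gmat // (derive_ht_sym b a _ Uy) (derive_ht_sym b e _ Uy).
by rewrite (derive_ht_sym e a _ Uy); field.
Qed.

Lemma WcovE e y : Wcov e y =
  H y *m ((\col_b 'D_(ev e) (Wt b) y) + Gmat e y *m Wcol y).
Proof.
apply/colP => a; rewrite !mxE; apply: eq_bigr => b _; rewrite !mxE.
by congr (_ * (_ + _)); apply: eq_bigr => c _; rewrite !mxE.
Qed.

Lemma is_derive_Wcol e y : Ut y ->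
  is_derive y (ev e) Wcol (\col_b 'D_(ev e) (Wt b) y).
Proof.
move=> Uy; apply/is_derive_mxP => a b.
rewrite (_ : (fun _ => _) = Wt a); last by apply/funext => y'; rewrite mxE.
by rewrite mxE; apply: derivableP; exact: derivable_Wt.
Qed.

Lemma is_derive_wcol e y : Ut y ->
  is_derive y (ev e) wcol (Wcov e y + (Gmat e y)^T *m wcol y).
Proof.
move=> Uy; rewrite (_ : wcol = fun y => H y *m Wcol y); last exact/funext/wcolE.
apply: (is_derive_eq (is_derive_mulmx (is_derive_hmat e Uy) (is_derive_Wcol e Uy))).
by rewrite WcovE mulmxDl mulmxDr !mulmxA addrC -addrA; congr (_ + _); rewrite addrC.
Qed.

Lemma is_derive_Wnorm2 e y : Ut y ->
  is_derive y (ev e) (Wnorm2 ht Wt) (2 * \tr ((Wcov e y)^T *m Wcol y)).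
Proof.
move=> Uy; rewrite (_ : Wnorm2 _ _ = fun y => \tr ((Wcol y)^T *m H y *m Wcol y));
  last exact/funext/Wnorm2E.
have dW := is_derive_Wcol e Uy.
apply: (is_derive_eq (is_derive_mxtrace (is_derive_mulmx (is_derive_mulmx
  (is_derive_trmx dW) (is_derive_hmat e Uy)) dW))).
rewrite WcovE; set d := \col_b _.
have E : \tr ((Wcol y)^T *m H y *m d) = \tr (d^T *m H y *m Wcol y).
  by rewrite -mxtrace_tr !trmx_mul trmxK hmat_sym // mulmxA.
have E' : \tr ((Wcol y)^T *m H y *m Gmat e y *m Wcol y) =
    \tr ((Wcol y)^T *m (Gmat e y)^T *m H y *m Wcol y).
  by rewrite -mxtrace_tr !trmx_mul trmxK hmat_sym // !mulmxA.
rewrite trmx_mul trmxD trmx_mul hmat_sym // !(mulmxDl, mulmxDr) !mxtraceD !mulmxA.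
by rewrite E E'; ring.
Qed.

Lemma sfrakE y z : sfrak ht Wt y z = navs (H y) (wcol y) (Wnorm2 ht Wt y) z.
Proof.
rewrite /sfrak /navs; congr (_ + _).
have uE i : (z^T *m wcol y) i 0 = Wi ht Wt y z 0 i.
  rewrite !mxE; apply: eq_bigr => a _.
  by rewrite [z^T _ _]mxE [wcol _ _ _]mxE mulrC.
rewrite mulmxA trace_mx11 mulmx3E; apply: eq_bigr => i _; apply: eq_bigr => j _.
by rewrite [_^T 0 i]mxE !uE -mulrA mulrC.
Qed.

Lemma calFE vol y z :
  calF ht Wt vol y z =
  dens (rho vol n) (chi vol n) (H y) (wcol y) (Wnorm2 ht Wt y) z.
Proof. by rewrite /calF /dens sfrakE. Qed.

(** Full rank makes [v |-> v *m z^T] injective, so the ambient form is evaluated at a nonzero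
    vector. *)
Lemma gram_posdef y z : Ut y -> \rank z = n -> forall v : 'rV[R]_n, v != 0 ->
  0 < (v *m (z^T *m H y *m z) *m v^T) 0 0.
Proof.
move=> Uy rz v v0.
have -> : v *m (z^T *m H y *m z) *m v^T = (v *m z^T) *m H y *m (v *m z^T)^T.
  by rewrite trmx_mul trmxK !mulmxA.
apply: ht_pos => //; apply: contra v0 => /eqP vz.
have fz : row_free z^T by rewrite /row_free mxrank_tr rz.
by rewrite -(mulmxKp fz v) vz mul0mx.
Qed.

(** The term [1 - t] is positive because the wind is subunit, and the remaining term is the Gram
    form evaluated at [q], hence nonnegative. *)
Lemma navs_gt0 y z : Ut y -> \rank z = n ->
  0 < navs (H y) (wcol y) (Wnorm2 ht Wt y) z.
Proof.
move=> Uy rz; rewrite /navs ltr_wpDr ?subr_gt0 ?Wt_lt1 //.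
have Ku : z^T *m H y *m z \in unitmx by exact/posdef_unitmx/gram_posdef.
set K := _ *m z in Ku *; set u := _ *m wcol y.
have Ksym : K^T = K by apply: K_sym; exact: hmat_sym.
pose q := (invmx K *m u)^T.
have -> : u^T *m (invmx K *m u) = q *m K *m q^T.
  by rewrite /q trmxK [(invmx K *m u)^T]trmx_mul trmx_inv Ksym mulmxKV.
have [->|q0] := eqVneq q 0; first by rewrite !mul0mx mxtrace0.
by rewrite trace_mx11; apply/ltW; exact: gram_posdef.
Qed.

(** The hypotheses are positivity conditions rather than a rank condition because positivity
    persists along lines, as the second differentiation requires. *)
Lemma is_derive_calF_jet vol y z W : Ut y -> 0 < \det (z^T *m H y *m z) ->
  0 < navs (H y) (wcol y) (Wnorm2 ht Wt y) z ->
  is_derive z W (calF ht Wt vol y)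
    (dens1 (rho vol n) (rho1 vol n) (chi vol n) W (H y) (wcol y) (Wnorm2 ht Wt y) z).
Proof.
set w := wcol y; set t := Wnorm2 ht Wt y => Uy det' s'.
have t_lt1 : t < 1 by exact: Wt_lt1.
have -> : calF ht Wt vol y = dens (rho vol n) (chi vol n) (H y) w t.
  by apply/funext => z'; exact: calFE.
have dH0 : is_derive z W (fun=> H y) ((0 : 'M[R]_N)^T *m H y + H y *m 0).
  apply: (is_derive_eq (is_derive_const (H y) z W)).
  by rewrite trmx0 mul0mx mulmx0 addr0.
have dw0 : is_derive z W (fun=> w) (0 + (0 : 'M[R]_N)^T *m w).
  apply: (is_derive_eq (is_derive_const w z W)).
  by rewrite trmx0 mul0mx addr0.
have d := is_derive_dens dH0 dw0 (is_derive_const t z W) (is_derive_id z W)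
  (hmat_sym Uy) det' (is_derive_chi vol n t_lt1) (lt0r_neq0 (chi_gt0 vol n t_lt1))
  (is_derive_rho vol n s').
apply: (is_derive_eq d).
rewrite /dens1 mul0mx addr0 oppr0 trmx0 mul0mx mxtrace0 mulr0 addr0 add0r mulr0 subr0.
rewrite tang_solve phiE ?hmat_sym // -KinvE mulmxA (mulmxA (Kinv _ _)) -AmxE.
by ring.
Qed.

Section Derivatives.
Variables (vol : volume) (y : 'rV[R]_N) (z : 'M[R]_(N, n)).
Hypotheses (Uy : Ut y) (rz : \rank z = n).

Let w := wcol y.
Let t := Wnorm2 ht Wt y.
Let s := navs (H y) w t z.
Let r0 := rho vol n s.
Let r1 := rho1 vol n s.
Let r2 := rho2 vol n s.
Let lc := logchi1 vol n t.
Let A := Amx (H y) z.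
Let a := tang (H y) z w.
Let nu := nrm (H y) z w.
Let D := Num.sqrt (\det (z^T *m H y *m z)) / chi vol n t.

(** [theta e] is the derivative of the squared norm of the wind; [sigma e] is the derivative of [s]
    with the contribution of the jet left out. *)
Definition theta e := 2 * \tr ((Wcov e y)^T *m Wcol y).
Definition sigma e := - theta e + 2 * \tr ((Wcov e y)^T *m (z *m a)).

Let det_gt0 : 0 < \det (z^T *m H y *m z).
Proof. exact/posdef_det_gt0/gram_posdef. Qed.

Let s_gt0 : 0 < s. Proof. exact: navs_gt0. Qed.

Let t_lt1 : t < 1. Proof. exact: Wt_lt1. Qed.

Let gram_u : z^T *m H y *m z \in unitmx.
Proof. by rewrite unitmxE unitfE gt_eqF. Qed.

Lemma derive_calF_point e :
  'D_(ev e) (fun y' => calF ht Wt vol y' z) y =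
  D * (r1 * sigma e - r0 * lc * theta e
       + \sum_b \sum_j dF_coef (H y) z w r0 r1 b j * (Gmat e y *m z) b j).
Proof.
have -> : (fun y' => calF ht Wt vol y' z) =
    fun y' => dens (rho vol n) (chi vol n) (H y') (wcol y') (Wnorm2 ht Wt y') z.
  by apply/funext => y'; exact: calFE.
have d := is_derive_dens (is_derive_hmat e Uy) (is_derive_wcol e Uy)
  (is_derive_Wnorm2 e Uy) (is_derive_const z y (ev e)) (hmat_sym Uy) det_gt0
  (is_derive_chi vol n t_lt1) (lt0r_neq0 (chi_gt0 vol n t_lt1))
  (is_derive_rho vol n s_gt0).
rewrite (@derive_val _ _ _ _ _ _ _ d) add0r -first_variationE /sigma /theta.
by rewrite -/w -/t -/s -/r1 -/r0 -/lc -/A -/a -/nu -/D; ring.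
Qed.

Lemma derive2_calF_jet e j X :
  'D_X ('D_(delta_mx e j) (calF ht Wt vol y)) z =
  D * \sum_b \sum_k d2F_coef (H y) z w r0 r1 r2 e j b k * X b k.
Proof.
have dH0 : is_derive z X (fun=> H y) ((0 : 'M[R]_N)^T *m H y + H y *m 0).
  apply: (is_derive_eq (is_derive_const (H y) z X)).
  by rewrite trmx0 mul0mx mulmx0 addr0.
have dw0 : is_derive z X (fun=> w) (0 + (0 : 'M[R]_N)^T *m w).
  apply: (is_derive_eq (is_derive_const w z X)).
  by rewrite trmx0 mul0mx addr0.
have dt0 := is_derive_const t z X.
have dz := is_derive_id z X.
have ddet := is_derive_det (is_derive_mulmx (is_derive_mulmx (is_derive_trmx dz) dH0) dz).
have ds := is_derive_navs dH0 dw0 dt0 dz (hmat_sym Uy) det_gt0.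
have d := is_derive_dens1 dH0 dw0 dt0 dz
  (hmat_sym Uy) det_gt0 (is_derive_chi vol n t_lt1) (lt0r_neq0 (chi_gt0 vol n t_lt1))
  (is_derive_rho vol n s_gt0) (is_derive_rho1 vol n s_gt0) (delta_mx e j).
have near_det := near_line_gt0 (@ex_derive _ _ _ _ _ _ _ ddet) det_gt0.
have near_s := near_line_gt0 (@ex_derive _ _ _ _ _ _ _ ds) s_gt0.
(* Near [z] on the line the first derivative has the closed form [dens1], so the second derivative
   is obtained by differentiating that form. *)
have nE : \forall h \near (0 : R), dens1 (rho vol n) (rho1 vol n) (chi vol n)
    (delta_mx e j) (H y) w t (h *: X + z) =
    'D_(delta_mx e j) (calF ht Wt vol y) (h *: X + z).
  near=> h; apply/esym/derive_val.
  by apply: is_derive_calF_jet => //; near: h.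
have d' := near_line_is_derive (g := 'D_(delta_mx e j) (calF ht Wt vol y)) nE d.
rewrite (@derive_val _ _ _ _ _ _ _ d') second_variationE ?hmat_sym //; congr (_ * _).
have z0 m k (i1 : 'I_m) (i2 : 'I_k) : (0 : 'M[R]_(m, k)) i1 i2 = 0 by rewrite mxE.
rewrite [X in _ + X + _]big1 => [|b _]; last by rewrite z0 mulr0.
rewrite !(trmx0, mul0mx, mulmx0, mxtrace0, oppr0, mulr0, addr0, mul0r, z0).
by [].
Unshelve. all: by end_near. Qed.

Lemma derive2_calF_mixed e g i :
  'D_(ev e) (fun y' => 'D_(delta_mx g i) (calF ht Wt vol y') z) y =
  D * (\sum_b \sum_j d2F_coef (H y) z w r0 r1 r2 g i b j * (Gmat e y *m z) b j
    + \sum_b dF_coef (H y) z w r0 r1 b i * Gmat e y b g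
    + (- lc * theta e * dF_coef (H y) z w r0 r1 g i
       + 2 * r2 * sigma e * nu g 0 * a i 0
       + 2 * r1 * (((Wcov e y)^T *m (1%:M - z *m (A *m H y))) 0 g * a i 0
                   + nu g 0 * (A *m Wcov e y) i 0)
       + r1 * sigma e * (A *m H y) i g)).
Proof.
have dH := is_derive_hmat e Uy.
have dw := is_derive_wcol e Uy.
have dt := is_derive_Wnorm2 e Uy.
have dz := is_derive_const z y (ev e).
have ddet := is_derive_det (is_derive_mulmx (is_derive_mulmx (is_derive_trmx dz) dH) dz).
have ds := is_derive_navs dH dw dt dz (hmat_sym Uy) det_gt0.
have d := is_derive_dens1 dH dw dt dz
  (hmat_sym Uy) det_gt0 (is_derive_chi vol n t_lt1) (lt0r_neq0 (chi_gt0 vol n t_lt1))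
  (is_derive_rho vol n s_gt0) (is_derive_rho1 vol n s_gt0) (delta_mx g i).
have near_det := near_line_gt0 (@ex_derive _ _ _ _ _ _ _ ddet) det_gt0.
have near_s := near_line_gt0 (@ex_derive _ _ _ _ _ _ _ ds) s_gt0.
have near_U := near_line_open (ev e) oUt Uy.
have nE : \forall h \near (0 : R), let y' := h *: ev e + y in
    dens1 (rho vol n) (rho1 vol n) (chi vol n)
      (delta_mx g i) (H y') (wcol y') (Wnorm2 ht Wt y') z =
    'D_(delta_mx g i) (calF ht Wt vol y') z.
  near=> h; apply/esym/derive_val.
  by apply: is_derive_calF_jet; near: h.
have d' := near_line_is_derive
  (g := fun y' => 'D_(delta_mx g i) (calF ht Wt vol y') z) nE d.
rewrite (@derive_val _ _ _ _ _ _ _ d') second_variationE ?hmat_sym //; congr (_ * _).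
by rewrite add0r.
Unshelve. all: by end_near. Qed.

End Derivatives.

End Navigation.

(** * Contraction with the second fundamental form *)


Section SymmetricContraction.
Context {R : realType} (N n : nat).
Variables (H : 'M[R]_N) (z : 'M[R]_(N, n)) (w : 'cV[R]_N).
Hypotheses (Hsym : H^T = H) (Ku : z^T *m H *m z \in unitmx).
Variables (r0 r1 r2 : R).

Local Notation Ki := (Kinv H z).
Local Notation A := (Amx H z).
Local Notation a := (tang H z w).
Local Notation nu := (nrm H z w).
Local Notation Q := (Qmx H z).
Local Notation AH := (A *m H).

(** The part of [d2F_coef] symmetric in [i] and [j]; it is also the coefficient of the second
    fundamental form in the stated formula. *)
Definition d2F_nrm g i e j :=
  Ki i j * (2 * r1 * (nu e 0 * nu g 0) + r0 * Q g e)
  + 2 * (a i 0 * a j 0) * (2 * r2 * (nu e 0 * nu g 0) - r1 * Q g e).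

Lemma sum_swap_sym (T : 'I_n -> 'I_n -> R) (k l : 'I_n -> R) :
  (forall i j, T i j = T j i) ->
  \sum_i \sum_j (k i * l j - l i * k j) * T i j = 0.
Proof.
move=> Tsym.
have E : \sum_i \sum_j (k i * l j) * T i j = \sum_i \sum_j (l i * k j) * T i j.
  rewrite exchange_big; apply: eq_bigr => j _; apply: eq_bigr => i _.
  by rewrite Tsym (mulrC (k i)).
rewrite -[RHS](subrr (\sum_i \sum_j (l i * k j) * T i j)) -{1}E -sumrB.
apply: eq_bigr => i _; rewrite -sumrB; apply: eq_bigr => j _.
by rewrite mulrBl.
Qed.

Lemma sum_d2F_sym g (T : 'I_N -> 'I_n -> 'I_n -> R) :
  (forall e i j, T e i j = T e j i) ->
  \sum_i \sum_j \sum_e d2F_coef H z w r0 r1 r2 g i e j * T e i j =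
  \sum_i \sum_j \sum_e d2F_nrm g i e j * T e i j.
Proof.
move=> Tsym.
have out (F : 'I_n -> 'I_n -> 'I_N -> R) :
    \sum_i \sum_j \sum_e F i j e = \sum_e \sum_i \sum_j F i j e.
  by under eq_bigr do rewrite exchange_big; rewrite exchange_big.
rewrite !out; apply: eq_bigr => e _.
pose AHg i := AH i g; pose AHe i := AH i e; pose ai i := a i 0.
(* The difference from [d2F_nrm] consists of three terms antisymmetric in [i] and [j], each
   annihilated by the symmetric [T e]. *)
transitivity (\sum_i \sum_j
   (r0 * ((AHg i * AHe j - AHe i * AHg j) * T e i j)
   + (2 * r1 * nu e 0 * ((AHg i * ai j - ai i * AHg j) * T e i j)
   + (2 * r1 * nu g 0 * ((ai i * AHe j - AHe i * ai j) * T e i j)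
   + d2F_nrm g i e j * T e i j)))).
  apply: eq_bigr => i _; apply: eq_bigr => j _.
  by rewrite /d2F_coef /d2F_nrm /AHg /AHe /ai; ring.
by rewrite !sumDZ !(sum_swap_sym _ _ (Tsym e)) !mulr0 !add0r.
Qed.

(** The index [e] enters [d2F_nrm] only through [nu e 0] and [Q g e], and both annihilate the
    columns of [z]. *)
Lemma sum_d2F_nrm_tangent g (c : 'I_n -> 'I_n -> 'I_n -> R) :
  \sum_i \sum_j \sum_e d2F_nrm g i e j * (\sum_k c k i j * z e k) = 0.
Proof.
apply: big1 => i _; apply: big1 => j _.
have nz k : \sum_e nu e 0 * z e k = 0.
  have /matrixP/(_ 0 k) := nrm_z w Hsym Ku; rewrite [RHS]mxE mxE => E.
  by rewrite -[RHS]E; apply: eq_bigr => e _; rewrite mxE.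
have Qz k : \sum_e Q g e * z e k = 0.
  by have /matrixP/(_ g k) := Qmx_z Ku; rewrite [RHS]mxE mxE.
under eq_bigr do rewrite mulr_sumr.
rewrite exchange_big; apply: big1 => k _ /=.
transitivity (c k i j * (Ki i j * (2 * r1 * nu g 0) + 2 * (a i 0 * a j 0) * (2 * r2 * nu g 0))
    * (\sum_e nu e 0 * z e k)
  + c k i j * (Ki i j * r0 - 2 * (a i 0 * a j 0) * r1) * \sum_e Q g e * z e k).
  rewrite !mulr_sumr -big_split; apply: eq_bigr => e _.
  by rewrite /d2F_nrm /=; ring.
by rewrite nz Qz !mulr0 addr0.
Qed.

End SymmetricContraction.

(** * The mean curvature form of an immersed submanifold *)

Section Submanifold.
Context {R : realType} (n p : nat).
Local Notation N := (n + p)%N.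
Variables (ht : 'I_N -> 'I_N -> 'rV[R]_N -> R) (Wt : 'I_N -> 'rV[R]_N -> R).
Variables (f : 'I_N -> 'rV[R]_n -> R) (U : set 'rV[R]_n) (Ut : set 'rV[R]_N).
Hypotheses (oU : open U) (oUt : open Ut).
Hypotheses (ht_smooth : forall a b, smooth_on Ut (ht a b))
  (Wt_smooth : forall a, smooth_on Ut (Wt a))
  (f_smooth : forall a, smooth_on U (f a))
  (ht_sym : forall a b y, Ut y -> ht a b y = ht b a y)
  (ht_pos : forall y, Ut y -> forall v : 'rV[R]_N,
      v != 0 -> 0 < (v *m hmat ht y *m v^T) 0 0)
  (Wt_lt1 : forall y, Ut y -> Wnorm2 ht Wt y < 1).
Variables (vol : volume) (x : 'rV[R]_n).
Hypotheses (Ux : U x) (Uy : Ut (fpt f x)) (rz : \rank (Jf f x) = n).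

Lemma d2f_sym e i j : d2f f e i j x = d2f f e j i x.
Proof.
have d1 v y : U y -> derivable (f e) y v.
  by move=> Uy'; have [_ /(_ y v Uy')] := f_smooth e [::].
have d2 u v y : U y -> derivable ('D_u (f e)) y v.
  by move=> Uy'; have [_ /(_ y v Uy')] := f_smooth e [:: u].
have c2 u v : {for x, continuous ('D_u ('D_v (f e)))}.
  by have [/(_ x Ux)] := f_smooth e [:: u; v].
exact: (derive_commute oU Ux (d1 _) (d1 _) (d2 _ _) (d2 _ _) (c2 _ _) (c2 _ _)).
Qed.

Let y := fpt f x.
Let z := Jf f x.
Let H := hmat ht y.
Let w := wcol ht Wt y.
Let t := Wnorm2 ht Wt y.
Let s := navs H w t z.
Let r0 := rho vol n s.
Let r1 := rho1 vol n s.
Let r2 := rho2 vol n s.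
Let lc := logchi1 vol n t.
Let A := Amx H z.
Let a := tang H z w.
Let nu := nrm H z w.
Let G e := Gmat ht e y.
Let om e := Wcov ht Wt e y.
Let th e := theta ht Wt y e.
Let sg e := sigma ht Wt y z e.
Let c1 e i := dF_coef H z w r0 r1 e i.
Let c2 g i e j := d2F_coef H z w r0 r1 r2 g i e j.

(** Second derivatives of f corrected by the ambient connection alone; [hess_tau2] shows that they
    differ from the second fundamental form by a tangent vector. *)
Definition hess e i j := d2f f e i j x + \sum_d z d i * (G d *m z) e j.

Lemma hess_sym e i j : hess e i j = hess e j i.
Proof.
rewrite /hess d2f_sym; congr (_ + _).
have E k l : \sum_d z d k * (G d *m z) e l =
    \sum_d \sum_b z d k * (Gt ht e d b y * z b l).
  apply: eq_bigr => d _; rewrite [X in _ * X]mxE mulr_sumr.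
  by apply: eq_bigr => b _; rewrite [X in _ * (X * _)]mxE.
rewrite !E exchange_big; apply: eq_bigr => d _; apply: eq_bigr => b _.
by rewrite (Gt_sym oUt ht_sym _ _ _ Uy); ring.
Qed.

Lemma hess_tau2 e i j : hess e i j =
  tau2 ht f e i j x + \sum_k GM ht f k i j x * z e k.
Proof.
rewrite /tau2 subrK /hess; congr (_ + _).
rewrite [RHS]exchange_big; apply: eq_bigr => d _ /=.
rewrite [X in _ * X]mxE mulr_sumr; apply: eq_bigr => b _.
rewrite [X in _ * (X * _)]mxE.
by rewrite (Gt_sym oUt ht_sym e d b Uy); ring.
Qed.

(** The part of the mixed derivative, up to the factor [D], that comes from the covariant derivative
    of the wind. *)
Definition mixed_rest g e i :=
  - lc * th e * c1 g i + 2 * r2 * sg e * nu g 0 * a i 0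
  + 2 * r1 * (((om e)^T *m (1%:M - z *m (A *m H))) 0 g * a i 0
              + nu g 0 * (A *m om e) i 0)
  + r1 * sg e * (A *m H) i g.

(** Each of the three terms of [Hmean] carries the factor [D], which cancels against F, equal to
    [D * r0]. *)
Lemma Hmean_contracted g :
  Hmean ht Wt f vol x g = r0^-1 *
    (r1 * sg g - r0 * lc * th g
     - \sum_e \sum_i mixed_rest g e i * z e i
     - \sum_i \sum_j \sum_e d2F_nrm H z w r0 r1 r2 g i e j * tau2 ht f e i j x).
Proof.
have Hsym : H^T = H by exact: (hmat_sym ht_sym Uy).
have Ku : z^T *m H *m z \in unitmx by exact: (posdef_unitmx (gram_posdef ht_pos Uy rz)).
have s0 : 0 < s by exact: (navs_gt0 ht_sym ht_pos Wt_lt1 Uy rz).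
have det0 : 0 < \det (z^T *m H *m z) by exact: (posdef_det_gt0 (gram_posdef ht_pos Uy rz)).
have t1 : t < 1 by exact: Wt_lt1.
pose D := Num.sqrt (\det (z^T *m H *m z)) / chi vol n t.
have D0 : D != 0.
  by rewrite mulf_neq0 ?invr_neq0 // gt_eqF ?sqrtr_gt0 ?(chi_gt0 vol n t1).
have r00 : r0 != 0 by rewrite gt_eqF // rho_gt0.
have EF : calF ht Wt vol y z = D * r0.
  by rewrite calFE /dens -/H -/w -/t -/s -/r0 /D; ring.
have E1 : 'D_(ev g) (fun y' => calF ht Wt vol y' z) y =
    D * (r1 * sg g - r0 * lc * th g + \sum_b \sum_j c1 b j * (G g *m z) b j).
  exact: (derive_calF_point oUt ht_smooth Wt_smooth ht_sym ht_pos Wt_lt1).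
have E2 e i j : 'D_(delta_mx g i) ('D_(delta_mx e j) (calF ht Wt vol y)) z =
    D * c2 g i e j.
  rewrite (derive2_calF_jet ht_sym ht_pos Wt_lt1) //; congr (_ * _).
  rewrite (bigD1 g) //= (bigD1 i) //= mxE !eqxx mulr1.
  rewrite !big1 ?addr0 => [|b bg|k ki].
  - by rewrite d2F_coefC.
  - by apply: big1 => k _; rewrite mxE (negPf bg) mulr0.
  - by rewrite mxE (negPf ki) andbF mulr0.
have E3 e i : 'D_(ev e) (fun y' => 'D_(delta_mx g i) (calF ht Wt vol y') z) y =
    D * (\sum_b \sum_j c2 g i b j * (G e *m z) b j
         + \sum_b c1 b i * G e b g + mixed_rest g e i).
  exact: (derive2_calF_mixed oUt ht_smooth Wt_smooth ht_sym ht_pos Wt_lt1).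
have S2 : \sum_i \sum_j \sum_e
    'D_(delta_mx g i) ('D_(delta_mx e j) (calF ht Wt vol y)) z * d2f f e i j x =
    D * \sum_i \sum_j \sum_e c2 g i e j * d2f f e i j x.
  rewrite mulr_sumr; apply: eq_bigr => i _; rewrite mulr_sumr; apply: eq_bigr => j _.
  by rewrite mulr_sumr; apply: eq_bigr => e _; rewrite E2 mulrA.
have Ca : \sum_e \sum_i (\sum_b \sum_j c2 g i b j * (G e *m z) b j) * z e i =
    \sum_i \sum_j \sum_b c2 g i b j * \sum_e z e i * (G e *m z) b j.
  rewrite exchange_big; apply: eq_bigr => i _ /=.
  under eq_bigr do rewrite exchange_big mulr_suml.
  rewrite exchange_big; apply: eq_bigr => j _ /=.
  under eq_bigr do rewrite mulr_suml.
  rewrite exchange_big; apply: eq_bigr => b _ /=; rewrite mulr_sumr.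
  by apply: eq_bigr => e _; rewrite mulrAC mulrA.
(* Torsion-freeness identifies this part of the mixed term with the connection term of the
   base-point derivative in [E1]; the two enter with opposite signs and cancel. *)
have Cb : \sum_e \sum_i (\sum_b c1 b i * G e b g) * z e i =
    \sum_b \sum_j c1 b j * (G g *m z) b j.
  under eq_bigr do under eq_bigr do rewrite mulr_suml.
  rewrite exchange_big [RHS]exchange_big; apply: eq_bigr => i _ /=.
  rewrite exchange_big; apply: eq_bigr => b _ /=.
  rewrite [X in _ = _ * X]mxE mulr_sumr; apply: eq_bigr => e _.
  rewrite [G e b g]mxE [X in _ = _ * (X * _)]mxE (Gt_sym oUt ht_sym b e g Uy).
  by rewrite mulrA.
have S3 : \sum_e \sum_i
    'D_(ev e) (fun y' => 'D_(delta_mx g i) (calF ht Wt vol y') z) y * z e i =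
    D * (\sum_i \sum_j \sum_b c2 g i b j * (\sum_e z e i * (G e *m z) b j)
         + \sum_b \sum_j c1 b j * (G g *m z) b j
         + \sum_e \sum_i mixed_rest g e i * z e i).
  rewrite -Ca -Cb -!big_split mulr_sumr; apply: eq_bigr => e _ /=.
  rewrite -!big_split mulr_sumr; apply: eq_bigr => i _ /=.
  by rewrite E3 -!mulrDl mulrA.
(* The Christoffel terms complete the second derivatives of f to [hess]. Symmetry reduces [d2F_coef]
   to [d2F_nrm], and the tangential part of [hess] then drops out, leaving [tau2]. *)
have Cc : \sum_i \sum_j \sum_e c2 g i e j * d2f f e i j x +
    \sum_i \sum_j \sum_b c2 g i b j * (\sum_e z e i * (G e *m z) b j) =
    \sum_i \sum_j \sum_e d2F_nrm H z w r0 r1 r2 g i e j * tau2 ht f e i j x.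
  transitivity (\sum_i \sum_j \sum_e c2 g i e j * hess e i j).
    rewrite -big_split; apply: eq_bigr => i _ /=; rewrite -big_split.
    apply: eq_bigr => j _ /=; rewrite -big_split; apply: eq_bigr => e _ /=.
    by rewrite /hess mulrDr.
  rewrite (sum_d2F_sym _ _ _ _ _ _ _ hess_sym).
  have tangent0 := sum_d2F_nrm_tangent w Hsym Ku r0 r1 r2 g
    (fun k i j => GM ht f k i j x).
  rewrite -[RHS]addr0 -[X in _ = _ + X]tangent0 -big_split; apply: eq_bigr => i _ /=.
  rewrite -big_split; apply: eq_bigr => j _ /=; rewrite -big_split.
  by apply: eq_bigr => e _ /=; rewrite hess_tau2 mulrDr.
rewrite /Hmean -/y -/z EF E1 S2 S3 -Cc.
by field; rewrite D0 r00.
Qed.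

(** The index sums of the stated formula factor into contractions with the covector [w]: [P] yields
    [nu], [A] yields [a], [B] yields [z *m a], and [Hi] yields [q]. *)
Lemma Hformula_contracted g :
  Hformula ht Wt f vol x g = r0^-1 *
    (r1 * sg g - r0 * lc * th g
     - \sum_e \sum_i mixed_rest g e i * z e i
     - \sum_i \sum_j \sum_e d2F_nrm H z w r0 r1 r2 g i e j * tau2 ht f e i j x).
Proof.
have Hsym : H^T = H by exact: (hmat_sym ht_sym Uy).
have Hu : H \in unitmx by exact: (hmat_unit ht_pos Uy).
have s0 : 0 < s by exact: (navs_gt0 ht_sym ht_pos Wt_lt1 Uy rz).
have r00 : r0 != 0 by rewrite gt_eqF // rho_gt0.
rewrite /Hformula -/y -/z sfrakE -/H -/w -/t -/s -/r0 -/r1 -/r2 -/lc.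
have -> : invmx (hz ht y z) = Kinv H z by rewrite KinvE.
rewrite -(mulmxA z) -AmxE -/A.
set B := z *m A; set P := 1%:M - B *m H; set Q := H - H *m (B *m H).
set Hi := invmx H - B.
have EQ : Q = Qmx H z by rewrite QmxE /Q /B !mulmxA.
pose za := z *m a.
have wE d : Wlow ht Wt y 0 d = w d 0 by rewrite /w [RHS]mxE.
have prodE (X Y : 'I_N -> R) :
    \sum_d \sum_k X d * Y k = (\sum_d X d) * (\sum_k Y k) by rewrite big_distrlr.
have nuE k : \sum_d w d 0 * P d k = nu k 0.
  have -> : nu k 0 = (w^T *m P) 0 k.
    transitivity (nu^T 0 k); first by rewrite mxE.
    rewrite nrm_tr // tangE trmx_mul (Amx_tr z Hsym) /P /B mulmxBr mulmx1 /A AmxE.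
    by rewrite !mulmxA.
  by rewrite mxE; apply: eq_bigr => d _; rewrite [w^T _ _]mxE.
have zaE e : \sum_d B e d * w d 0 = za e 0.
  by rewrite /za /a tangE mulmxA [RHS]mxE.
have aE i : \sum_d w d 0 * A i d = a i 0.
  by rewrite /a tangE [RHS]mxE; apply: eq_bigr => d _; rewrite mulrC.
(* Contravariant components of the normal part of the wind; [sigma] is [- 2] times the pairing of
   the covariant derivative with [q]. *)
pose q al := Wt al y - za al 0.
have qE al : \sum_d Hi al d * w d 0 = q al.
  transitivity ((Hi *m w) al 0); first by rewrite mxE.
  rewrite /Hi mulmxBl {1}/w wcolE mulKmx // /q /za /a tangE -(mulmxA z).
  by rewrite [LHS]mxE [X in X + _]mxE [X in _ + X]mxE.
pose Om e al := Wlowcov ht Wt al e y.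
have thE e : th e = 2 * \sum_al Om e al * Wt al y.
  rewrite /th /theta trace_mx11 [X in _ * X]mxE; congr (_ * _).
  by apply: eq_bigr => al _; rewrite [X in X * _]mxE [X in X * _]mxE [X in _ * X]mxE.
have sgE e : sg e = - 2 * \sum_al Om e al * q al.
  rewrite /sg /sigma -/(th e) thE trace_mx11 [X in _ + _ * X]mxE -/H -/w -/a -/za.
  have -> : \sum_al Om e al * q al =
      \sum_al Om e al * Wt al y - \sum_al Om e al * za al 0.
    by rewrite -sumrB; apply: eq_bigr => al _; rewrite mulrBr.
  have -> : \sum_al (Wcov ht Wt e y)^T 0 al * za al 0 = \sum_al Om e al * za al 0.
    by apply: eq_bigr => al _; rewrite [X in X * _]mxE [X in X * _]mxE.
  by ring.
have omPE e : \sum_al P al g * Om e al = ((om e)^T *m P) 0 g.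
  rewrite mxE; apply: eq_bigr => al _.
  by rewrite [X in _ = X * _]mxE [X in _ = X * _]mxE mulrC.
have BomE e : \sum_al B e al * Om e al = \sum_i (A *m om e) i 0 * z e i.
  transitivity ((z *m (A *m om e)) e 0).
    by rewrite mulmxA mxE; apply: eq_bigr => al _; rewrite [X in _ = _ * X]mxE.
  by rewrite mxE; apply: eq_bigr => i _; rewrite mulrC.
have T1 : \sum_e \sum_al
    (2 * r1 * (\sum_d \sum_k B e d * Wlow ht Wt y 0 d * Wlow ht Wt y 0 k * P k g)
     - r0 * P e g) * Wlowcov ht Wt al e y * Wt al y =
    \sum_e (2 * r1 * (za e 0 * nu g 0) - r0 * P e g) * (th e / 2).
  apply: eq_bigr => e _.
  have -> : \sum_d \sum_k B e d * Wlow ht Wt y 0 d * Wlow ht Wt y 0 k * P k g =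
      za e 0 * nu g 0.
    rewrite -zaE -nuE -prodE; apply: eq_bigr => d _; apply: eq_bigr => k _.
    by rewrite !wE mulrA.
  have -> : th e / 2 = \sum_al Om e al * Wt al y by rewrite thE; field.
  rewrite mulr_sumr.
  by apply: eq_bigr => al _; rewrite -[LHS]mulrA.
have T3 i j e : Kinv H z i j *
    (2 * r1 * (\sum_al \sum_be
       Wlow ht Wt y 0 al * Wlow ht Wt y 0 be * P al e * P be g) + r0 * Q g e) +
    2 * (\sum_d \sum_k Wlow ht Wt y 0 d * Wlow ht Wt y 0 k * A i d * A j k) *
    (2 * r2 * (\sum_al \sum_be
       Wlow ht Wt y 0 al * Wlow ht Wt y 0 be * P al e * P be g) - r1 * Q g e) =
    d2F_nrm H z w r0 r1 r2 g i e j.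
  have -> : \sum_al \sum_be
       Wlow ht Wt y 0 al * Wlow ht Wt y 0 be * P al e * P be g = nu e 0 * nu g 0.
    rewrite -!nuE -prodE; apply: eq_bigr => d _; apply: eq_bigr => k _.
    by rewrite !wE; ring.
  have -> : \sum_d \sum_k Wlow ht Wt y 0 d * Wlow ht Wt y 0 k * A i d * A j k =
      a i 0 * a j 0.
    rewrite -!aE -prodE; apply: eq_bigr => d _; apply: eq_bigr => k _.
    by rewrite !wE; ring.
  by rewrite EQ.
rewrite T1.
have -> : \sum_i \sum_j \sum_e (Kinv H z i j *
    (2 * r1 * (\sum_al \sum_be
       Wlow ht Wt y 0 al * Wlow ht Wt y 0 be * P al e * P be g) + r0 * Q g e) +
    2 * (\sum_d \sum_k Wlow ht Wt y 0 d * Wlow ht Wt y 0 k * A i d * A j k) *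
    (2 * r2 * (\sum_al \sum_be
       Wlow ht Wt y 0 al * Wlow ht Wt y 0 be * P al e * P be g) - r1 * Q g e)) *
     tau2 ht f e i j x =
    \sum_i \sum_j \sum_e d2F_nrm H z w r0 r1 r2 g i e j * tau2 ht f e i j x.
  by apply: eq_bigr => i _; apply: eq_bigr => j _; apply: eq_bigr => e _; rewrite T3.
set T3s := \sum_i \sum_j \sum_e d2F_nrm _ _ _ _ _ _ _ _ _ _ * _.
have T2 : \sum_al \sum_be \sum_e
    (2 * r1 * (Hi al be * P e g + B e al * P be g) -
     2 * B e be * (2 * r2 * (\sum_d \sum_k
        Hi al d * Wlow ht Wt y 0 d * Wlow ht Wt y 0 k * P k g) - r1 * P al g)) *
    Wlowcov ht Wt al e y * Wlow ht Wt y 0 be =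
    \sum_e (- r1 * P e g * sg e + 2 * r1 * nu g 0 * (\sum_i (A *m om e) i 0 * z e i)
      + 2 * za e 0 * (r2 * nu g 0 * sg e + r1 * ((om e)^T *m P) 0 g)).
  have HiE al : \sum_d \sum_k
      Hi al d * Wlow ht Wt y 0 d * Wlow ht Wt y 0 k * P k g = q al * nu g 0.
    rewrite -qE -nuE -prodE; apply: eq_bigr => d _; apply: eq_bigr => k _.
    by rewrite !wE mulrA.
  transitivity (\sum_al \sum_e \sum_be (
      (2 * r1 * P e g * Om e al) * (Hi al be * w be 0)
      + ((2 * r1 * B e al * Om e al) * (w be 0 * P be g)
      + (- 2 * (2 * r2 * (q al * nu g 0) - r1 * P al g) * Om e al) * (B e be * w be 0)))).
    apply: eq_bigr => al _; rewrite exchange_big; apply: eq_bigr => e _.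
    by apply: eq_bigr => be _; rewrite HiE wE /Om; ring.
  rewrite exchange_big; apply: eq_bigr => e _ /=.
  rewrite sgE -BomE -omPE.
  transitivity (\sum_al (2 * r1 * P e g * (Om e al * q al)
      + (2 * r1 * nu g 0 * (B e al * Om e al)
      + (- 4 * r2 * nu g 0 * za e 0 * (Om e al * q al)
      + 2 * r1 * za e 0 * (P al g * Om e al))))).
    apply: eq_bigr => al _; rewrite !big_split -!mulr_sumr /= qE nuE zaE.
    by ring.
  rewrite !big_split -!mulr_sumr /=.
  by ring.
rewrite T2.
have restE e : \sum_i mixed_rest g e i * z e i =
    - lc * th e * (2 * r1 * nu g 0 * za e 0 + r0 * (B *m H) e g)
    + 2 * r2 * sg e * nu g 0 * za e 0
    + 2 * r1 * (((om e)^T *m P) 0 g * za e 0 + nu g 0 * (\sum_i (A *m om e) i 0 * z e i))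
    + r1 * sg e * (B *m H) e g.
  rewrite [za e 0]mxE /B -(mulmxA z) [(z *m (A *m H)) e g]mxE.
  transitivity (\sum_i (
     (- lc * th e * 2 * r1 * nu g 0 + 2 * r2 * sg e * nu g 0
        + 2 * r1 * ((om e)^T *m P) 0 g) * (z e i * a i 0)
     + ((- lc * th e * r0 + r1 * sg e) * (z e i * (A *m H) i g)
     + 2 * r1 * nu g 0 * ((A *m om e) i 0 * z e i)))).
    apply: eq_bigr => i _.
    by rewrite /mixed_rest /c1 /dF_coef -/A -/a -/nu /P /B -(mulmxA z); ring.
  rewrite !big_split -!mulr_sumr /=.
  by ring.
under [in RHS]eq_bigr do rewrite restE.
(* The free term at index [g] becomes a sum against the Kronecker delta, which together with
   [B *m H] forms [P]; the two sides are then compared for each [e]. *)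
have delta (F : 'I_N -> R) : F g = \sum_e (e == g)%:R * F e.
  rewrite (bigD1 g) //= eqxx mul1r big1 ?addr0 // => e /negPf ->.
  by rewrite mul0r.
have PE e : P e g = (e == g)%:R - (B *m H) e g.
  by rewrite /P [LHS]mxE [X in X + _]mxE [X in _ + X]mxE.
rewrite (delta (fun e => r1 * sg e - r0 * lc * th e)) mulrAC -(mulrC r0^-1) -mulrA.
rewrite -mulrBr -mulrBr; congr (_ * (_ - _)).
rewrite mulr_sumr -!sumrB; apply: eq_bigr => e _.
by rewrite PE; field.
Qed.

End Submanifold.

Theorem theorem2p1 (R : realType) (n p : nat)
  (ht : 'I_(n + p) -> 'I_(n + p) -> 'rV[R]_(n + p) -> R)
  (Wt : 'I_(n + p) -> 'rV[R]_(n + p) -> R)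
  (f : 'I_(n + p) -> 'rV[R]_n -> R)
  (U : set 'rV[R]_n) (Ut : set 'rV[R]_(n + p)) :
  open U -> open Ut ->
  (forall x, U x -> Ut (fpt f x)) ->
  (forall a b, smooth_on Ut (ht a b)) ->
  (forall a, smooth_on Ut (Wt a)) ->
  (forall a, smooth_on U (f a)) ->
  (forall a b y, Ut y -> ht a b y = ht b a y) ->
  (forall y, Ut y -> forall v : 'rV[R]_(n + p),
      v != 0 -> 0 < (v *m hmat ht y *m v^T) 0 0) ->
  (forall y, Ut y -> Wnorm2 ht Wt y < 1) ->
  (forall x, U x -> \rank (Jf f x) = n) ->
  forall (vol : volume) (x : 'rV[R]_n), U x -> forall gam : 'I_(n + p),
    Hmean ht Wt f vol x gam = Hformula ht Wt f vol x gam.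
Proof.
move=> oU oUt fU ht_smooth Wt_smooth f_smooth ht_sym ht_pos Wt_lt1 rz vol x Ux gam.
have Uy := fU x Ux; have rzx := rz x Ux.
(* Both sides reduce to the same contracted expression at [x]. *)
by rewrite (Hmean_contracted oU oUt ht_smooth Wt_smooth f_smooth ht_sym ht_pos Wt_lt1
  vol Ux Uy rzx) (Hformula_contracted ht_sym ht_pos Wt_lt1 vol Uy rzx).
Qed.
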